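(* Let $p\in\mathbb N$, $\alpha_0>-1$, and let $c_1,\dots,c_p>0$ be pairwise distinct. Let $\vec n=(n_1,\dots,n_p)\in\mathbb N_0^p$ and $i\in\{1,\dots,p\}$ with $n_i\ge1$. Then the multiple Laguerre polynomial of the second kind of type I, $L^{(i)}_{\vec n}(x;c_1,\dots,c_p,\alpha_0)$ (defined by the orthogonality conditions in the context), is $$L^{(i)}_{\vec n}(x;c_1,\dots,c_p,\alpha_0)=K_{i}\;F^{1:0;1;\cdots;1}_{1:0;0;\cdots;0}\left[\begin{matrix}-n_i+1:\,--;\{n_q\}_{q\ne i}\\ \alpha_0+|\vec n|-n_i+1:\,--;\cdots;--\end{matrix}\,\Bigg|\;c_ix,\left\{\frac{c_i}{c_i-c_q}\right\}_{q\ne i}\right]$$ $$=K_i\sum_{l_1=0}^{n_i-1}\sum_{l_2=0}^{n_i-1-l_1}\cdots\sum_{l_p=0}^{n_i-1-l_1-\cdots-l_{p-1}}\frac{(-n_i+1)_{l_1+\cdots+l_p}}{(\alpha_0+|\vec n|-n_i+1)_{l_1+\cdots+l_p}}\,\frac{c_i^{l_1+\cdots+l_p}}{l_i!}\prod_{q=1,q\ne i}^p\frac{(n_q)_{l_q}}{l_q!\,(c_i-c_q)^{l_q}}\;x^{l_i},$$ where $$K_i=\frac{(-1)^{n_i-1}c_i^{\alpha_0+|\vec n|}(\alpha_0+|\vec n|-n_i+1)_{n_i-1}}{(n_i-1)!\,\Gamma(\alpha_0+|\vec n|)}\prod_{q=1,q\ne i}^p\left(\frac{c_q}{c_q-c_i}\right)^{n_q}.$$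 Moreover, it is obtained from the type I Jacobi--Piñeiro polynomials $P^{(i)}_{\vec n}(x;\alpha_1,\dots,\alpha_p,\beta)$ given in the context by the limit $$L^{(i)}_{\vec n}(x;c_1,\dots,c_p,\alpha_0)=\lim_{t\to\infty}\frac{(-1)^{|\vec n|-1}}{t^{\alpha_0+|\vec n|}}\,P^{(i)}_{\vec n}\left(1-\frac xt;\,c_1t,\dots,c_pt,\,\alpha_0\right).$$
   Context: $\mathbb N_0=\{0,1,2,\dots\}$; $|\vec n|=n_1+\cdots+n_p$; $(x)_0=1$, $(x)_n=x(x+1)\cdots(x+n-1)$. The multiple Laguerre polynomials of the second kind of type I, for $|\vec n|\ge1$, are the unique polynomials $L^{(1)}_{\vec n},\dots,L^{(p)}_{\vec n}$ with $\deg L^{(i)}_{\vec n}\le n_i-1$ ($L^{(i)}_{\vec n}=0$ if $n_i=0$) satisfying $$\sum_{i=1}^p\int_0^\infty x^jL^{(i)}_{\vec n}(x)\,x^{\alpha_0}e^{-c_ix}\,dx=\begin{cases}0,&j=0,\dots,|\vec n|-2,\\1,&j=|\vec n|-1.\end{cases}$$ The multiple Kampé de Fériet series used is the $p$-fold series (summation indices $l_i$ and $l_q$, $q\ne i$) $$F^{1:0;1;\cdots;1}_{1:0;0;\cdots;0}\left[\begin{matrix}a:\,--;\{b_q\}_{q\ne i}\\ d:\,--;\cdots;--\end{matrix}\,\Bigg|\;y_i,\{y_q\}_{q\ne i}\right]=\sum_{l_1=0}^\infty\cdots\sum_{l_p=0}^\infty\frac{(a)_{l_1+\cdots+l_p}}{(d)_{l_1+\cdots+l_p}}\,\frac{y_i^{l_i}}{l_i!}\prod_{q\ne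 i}\frac{(b_q)_{l_q}\,y_q^{l_q}}{l_q!}$$ (which terminates when $a$ is a non-positive integer). The type I Jacobi--Piñeiro polynomials are, for $n_i\ge 1$, $$P^{(i)}_{\vec n}(x;\alpha_1,\dots,\alpha_p,\beta)=(-1)^{|\vec n|-1}\frac{\prod_{q=1}^p(\alpha_q+\beta+|\vec n|)_{n_q}}{(n_i-1)!\prod_{q\ne i}(\alpha_q-\alpha_i)_{n_q}}\,\frac{\Gamma(\alpha_i+\beta+|\vec n|)}{\Gamma(\beta+|\vec n|)\Gamma(\alpha_i+1)}\sum_{l=0}^{n_i-1}\frac{(-n_i+1)_l(\alpha_i+\beta+|\vec n|)_l}{l!\,(\alpha_i+1)_l}\prod_{q\ne i}\frac{(\alpha_i-\alpha_q-n_q+1)_l}{(\alpha_i-\alpha_q+1)_l}\,x^l ,$$ which is well defined for the parameters in the limit as soon as $t$ is large enough. *)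

(* Defs.v *)
From HB Require Import structures.
From mathcomp Require Export all_boot all_order all_algebra.
From mathcomp Require Export all_classical all_reals all_analysis.

Set Implicit Arguments.
Unset Strict Implicit.
Unset Printing Implicit Defensive.

Import Order.TTheory GRing.Theory Num.Theory.
Import numFieldNormedType.Exports.

Local Open Scope classical_set_scope.
Local Open Scope ring_scope.

Section SpecialFunctions.
Context {R : realType}.

Definition poch (x : R) (n : nat) : R := \prod_(k < n) (x + k%:R).

(* Euler's integral; it is Gamma only at arguments s > 0. *)
Definition Gamma (s : R) : R :=
  \int[@lebesgue_measure R]_(x in `]0, +oo[) (x `^ (s - 1) * expR (- x)).

(* A p-tuple (l_1, ..., l_p) of summation indices is passed to the summand as
   the sequence [:: l_1; ...; l_p], so that [nth 0%N l q] is the index attached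
   to q : 'I_p. *)

(* sum_(l_1 = 0)^oo ... sum_(l_p = 0)^oo f (l_1, ..., l_p), as iterated limits
   of partial sums *)
Fixpoint multi_series (p : nat) (f : seq nat -> R) : R :=
  if p is p'.+1 then
    limn (fun N : nat =>
      \sum_(0 <= l < N) multi_series p' (fun s => f (l :: s)))
  else f [::].

(* sum_(l_1 = 0)^m sum_(l_2 = 0)^(m - l_1) ... sum_(l_p = 0)^(m - l_1 - ... -
   l_(p-1)) f (l_1, ..., l_p) *)
Fixpoint nested_sum (p m : nat) (f : seq nat -> R) : R :=
  if p is p'.+1 then
    \sum_(0 <= l < m.+1) nested_sum p' (m - l) (fun s => f (l :: s))
  else f [::].

(* F^{1:0;1;...;1}_{1:0;0;...;0}[a : --; {b_q}_(q != i) / d : --; ...; -- |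
   yi, {y_q}_(q != i)]; the values b i and y i are not used. *)
Definition kampe_de_feriet (p : nat) (i : 'I_p) (a : R) (b : 'I_p -> R)
    (d yi : R) (y : 'I_p -> R) : R :=
  multi_series p (fun l =>
    poch a (sumn l) / poch d (sumn l)
    * (yi ^+ nth 0%N l i / (nth 0%N l i)`!%:R)
    * \prod_(q < p | q != i)
        (poch (b q) (nth 0%N l q) * y q ^+ nth 0%N l q / (nth 0%N l q)`!%:R)).

End SpecialFunctions.

Section MultipleOrthogonalPolynomials.
Context {R : realType} {p : nat}.

Definition mabs (n : 'I_p -> nat) : nat := (\sum_(q < p) n q)%N.

(* The degree bound deg (L i) <= n i - 1, with L i = 0 when n i = 0, reads
   size (L i) <= n i. *)
Definition is_laguerre2_typeI (n : 'I_p -> nat) (c : 'I_p -> R) (alpha0 : R)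
    (L : {ffun 'I_p -> {poly R}}) : Prop :=
  (forall i, (size (L i) <= n i)%N) /\
  (forall j, (j < mabs n)%N ->
    \sum_(i < p) \int[@lebesgue_measure R]_(x in `]0, +oo[)
       (x ^+ j * (L i).[x] * (x `^ alpha0 * expR (- (c i * x))))
    = if j == (mabs n).-1 then 1 else 0).

(* Meaningful for n i >= 1 only. *)
Definition jacobi_pineiro_typeI (n : 'I_p -> nat) (alpha : 'I_p -> R)
    (beta : R) (i : 'I_p) : {poly R} :=
  ((-1) ^+ (mabs n).-1
   * ((\prod_(q < p) poch (alpha q + beta + (mabs n)%:R) (n q))
      / ((n i).-1`!%:R
         * \prod_(q < p | q != i) poch (alpha q - alpha i) (n q)))
   * (Gamma (alpha i + beta + (mabs n)%:R)
      / (Gamma (beta + (mabs n)%:R) * Gamma (alpha i + 1))))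
  *: \sum_(0 <= l < n i)
       (poch (- (n i)%:R + 1) l * poch (alpha i + beta + (mabs n)%:R) l
        / (l`!%:R * poch (alpha i + 1) l)
        * \prod_(q < p | q != i)
            (poch (alpha i - alpha q - (n q)%:R + 1) l
             / poch (alpha i - alpha q + 1) l)) *: 'X^l.

Definition laguerre2_const (n : 'I_p -> nat) (c : 'I_p -> R) (alpha0 : R)
    (i : 'I_p) : R :=
  (-1) ^+ (n i).-1 * c i `^ (alpha0 + (mabs n)%:R)
  * poch (alpha0 + (mabs n)%:R - (n i)%:R + 1) (n i).-1
  / ((n i).-1`!%:R * Gamma (alpha0 + (mabs n)%:R))
  * \prod_(q < p | q != i) (c q / (c q - c i)) ^+ n q.

End MultipleOrthogonalPolynomials.

(* Main.v *)
Require Import Defs.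
From mathcomp Require Import measurable_realfun ring lra zify.

Set Implicit Arguments.
Unset Strict Implicit.
Unset Printing Implicit Defensive.

Import Order.TTheory GRing.Theory Num.Theory.
Import numFieldNormedType.Exports.

Local Open Scope classical_set_scope.
Local Open Scope ring_scope.

(** Write N = |n|, m = n_i - 1, a = alpha0 + 1 and b = alpha0 + N - 1.  All the
    formulas come from one power series in u,
      W(u) = e^(c_i x u) (1 - u)^b
               * prod_(q != i) (1 - c_i u / (c_i - c_q))^(- n_q):
    the value L_i(x) is the coefficient of u^m in W(u), times
      C = c_i^(alpha0 + N) / Gamma(alpha0 + N)
            * prod_(q != i) (c_q / (c_q - c_i))^(n_q)
    ([laguerre_horner]).  Under s = c_i (1 - u) this coefficient is, up to a
    constant factor, e^(c_i x) times the residue at s = c_i of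
    s^b e^(- x s) / prod_q (s - c_q)^(n_q).

    The orthogonality conditions yield it by duality.  Euler's integral turns
    them into linear equations in the coefficients of the L_q, with entries
    proportional to (a)_(j + k) / c_q^(j + k).  Combining these equations with
    weights r_j / (a)_j, j < N, the coefficient of x^k in L_q gets multiplied,
    up to an explicit factor, by the k-th Taylor coefficient at c_q of
    s^(- a - N + 1) G(s), where G(s) = sum_j r_j s^(N - 1 - j) is an arbitrary
    polynomial of degree < N ([laplace_momentE]).  Choosing G divisible by
    (s - c_q)^(n_q) for each q != i, and such that its product with
    s^(- a - N + 1) agrees with a multiple of (s - c_i)^k0 to order n_i at c_i,
    keeps exactly the coefficient of x^k0 in L_i ([coef_isolation]).  Only the
    last equation has a nonzero right-hand side, so this coefficient equals G(0)
    up to explicit factors, and G(0) reduces in the same way to the value at 0 of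
    a Taylor polynomial at c_i; in the variable u that is a sum of the first
    coefficients of a power series, that is, one coefficient of its product with
    1 / (1 - u).  The computation
    proves uniqueness and the formula at once, and existence follows because the
    linear system is square ([laguerre_exists_unique]).

    The nested sum is the coefficient of u^m in W(u) written out
    ([nested_sum_prod]), and the hypergeometric series is the same sum, its
    terms with index sum beyond m being zero ([multi_series_nested_sum]).

    For the limit, the finite sum in the Jacobi-Pineiro polynomial is an m-th
    difference at 0 of a product f_t(l) of powers (1 - x / t)^l and of ratios
    (c t + a')_l / (c t + b')_l.  For each factor, t^k times the k-th difference
    has a limit, namely k! times the k-th coefficient of a power series,
    e^(- x v) or (1 + v / c)^(a' - b'); such limits multiply like the power
    series ([expandsM]).  With v = - c_i u the product of these series is W(u).
    The remaining factors are elementary except a quotient of Gamma functions,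
    whose asymptotics follow from the inequality
    Gamma(z + a) <= z^a Gamma(z), 0 <= a <= 1 ([Gamma_le], [Gamma_ratio]). *)

(** * Euler's integral *)

Section Gamma.
Context {R : realType}.
Local Notation mu := (@lebesgue_measure R).
Implicit Types (a s c x z : R).

(** The primitive need only have limits at both ends: this covers integrands
    such as x^(s - 1) e^(- c x) with s < 1, which blow up at 0. *)
Lemma ge0_FTC_0y (f F : R -> R) (l0 l : R) :
  (forall x, 0 < x -> 0 <= f x) ->
  (forall x, 0 < x -> derivable F x 1 /\ 'D_1 F x = f x) ->
  {in `]0, +oo[, continuous f} ->
  F x @[x --> 0^'+] --> l0 -> F x @[x --> +oo] --> l ->
  (\int[mu]_(x in `]0%R, +oo[) (f x)%:E = (l - l0)%:E)%E.
Proof.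
move=> f0 dF cf F0 Fy.
pose D := fun n : nat => `[(n.+1%:R^-1 : R), +oo[%classic.
(* The half-line is exhausted by the intervals [1 / (n + 1), +oo[. *)
have a0 n : 0 < n.+1%:R^-1 :> R by rewrite invr_gt0 ltr0n.
have UD : `]0, +oo[%classic = \bigcup_n D n :> set R.
  apply/seteqP; split => [x|x [n _]]; rewrite /D /= !in_itv /= !andbT; last first.
    exact: lt_le_trans.
  move=> x0; exists (Num.truncn x^-1) => //=; rewrite in_itv /= andbT.
  rewrite -[leRHS]invrK lef_pV2 ?posrE ?invr_gt0 ?ltr0n//.
  by rewrite ltW// truncnS_gt.
have cfD n : {in `](n.+1%:R^-1 : R), +oo[, continuous f}.
  move=> x; rewrite in_itv /= andbT => nx; apply: cf.
  by rewrite in_itv /= andbT (lt_trans _ nx).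
have mf n : measurable_fun (D n) (fun x => (f x)%:E).
  apply/measurable_EFinP; apply: (measurable_funS (measurable_itv (`]0, +oo[ : interval R))).
    by move=> x; rewrite /D /= !in_itv /= !andbT; exact: lt_le_trans.
  apply: open_continuous_measurable_fun => //.
  by move=> x; rewrite inE; exact: cf.
have FTC n : (\int[mu]_(x in D n) (f x)%:E = l%:E - (F n.+1%:R^-1)%:E)%E.
  apply: ge0_continuous_FTC2y => //.
  - by move=> x ax; apply: f0; apply: lt_le_trans ax.
  - apply/continuous_within_itvcyP; split; first exact: cfD.
    by apply: cvg_at_right_filter; apply: cf; rewrite in_itv/= andbT.
  - by move=> x ax; have [] := dF _ (lt_trans (a0 n) ax).
  - apply: cvg_at_right_filter.
    apply: differentiable_continuous; apply/derivable1_diffP.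
    by have [] := dF _ (a0 n).
  - move=> x; rewrite in_itv/= andbT => ax; rewrite derive1E.
    by have [] := dF _ (lt_trans (a0 n) ax).
have c1 : (\int[mu]_(x in D n) (f x)%:E @[n --> \oo] -->
    \int[mu]_(x in `]0%R, +oo[) (f x)%:E)%E.
  rewrite UD; apply: ge0_nondecreasing_set_cvg_integral => //.
  - apply/nondecreasing_seqP => n; rewrite subsetEset /D => x /=.
    rewrite !in_itv /= !andbT; apply: le_trans.
    by rewrite lef_pV2 ?posrE ?ltr0n// ler_nat.
  - by move=> n; exact: measurable_itv.
  - move=> n x; rewrite /D /= in_itv/= andbT => ax; rewrite lee_fin f0//.
    exact: lt_le_trans ax.
have c2 : (\int[mu]_(x in D n) (f x)%:E @[n --> \oo] --> (l - l0)%:E)%E.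
  under eq_fun do rewrite FTC -EFinB.
  apply: cvg_EFin; first exact: nearW.
  apply: cvgB; first exact: cvg_cst.
  move/cvg_at_rightP : F0 => /(_ harmonic); apply; split => //.
  exact: cvg_harmonic.
exact: (cvg_unique _ c1 c2).
Qed.

Definition euler_kernel s c x : R := x `^ (s - 1) * expR (- (c * x)).

Lemma euler_kernel_ge0 s c x : 0 <= euler_kernel s c x.
Proof. by rewrite mulr_ge0 ?powR_ge0 ?expR_ge0. Qed.

Lemma is_derive_expRM c x :
  is_derive x 1 (fun y => expR (- (c * y))) (- c * expR (- (c * x))).
Proof.
apply: is_derive_eq; rewrite /GRing.scale /=; ring.
Qed.

Lemma continuous_expRM c : continuous (fun y => expR (- (c * y))).
Proof.
move=> x; apply: differentiable_continuous; apply/derivable1_diffP.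
by apply: ex_derive; apply: is_derive_expRM.
Qed.

Lemma is_derive_powR_expRM s c x : 0 < x ->
  is_derive x 1 (fun y => y `^ s * expR (- (c * y)))
    (s * euler_kernel s c x - c * euler_kernel (s + 1) c x).
Proof.
move=> x0; have dp := is_derive1_powR s x0.
have de := is_derive_expRM c x.
apply: is_derive_eq; rewrite /euler_kernel addrK /GRing.scale /=; ring.
Qed.

Lemma continuous_euler_kernel s c : {in `]0, +oo[, continuous (euler_kernel s c)}.
Proof.
move=> x; rewrite in_itv /= andbT => x0.
apply: differentiable_continuous; apply/derivable1_diffP.
by apply: ex_derive; apply: is_derive_powR_expRM.
Qed.

Lemma cvgy_expRM c : 0 < c -> expR (- (c * x)) @[x --> +oo] --> 0.
Proof.
move=> c0; apply: (@cvg_comp _ _ _ (fun x => c * x) (fun y => expR (- y)) _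
  (pinfty_nbhs R)); last exact: cvgr_expR.
exact: gt0_cvgMry.
Qed.

(** This is y <= e^y at y = d x / s, raised to the power s. *)
Lemma powR_le_expR s d x : 0 < s -> 0 < d -> 0 <= x ->
  x `^ s <= (s / d) `^ s * expR (d * x).
Proof.
move=> s0 d0 x0.
have -> : expR (d * x) = expR (d * x / s) `^ s.
  by rewrite /powR gt_eqF ?expR_gt0// expRK; congr expR; field; rewrite gt_eqF.
rewrite -powRM ?expR_ge0 ?divr_ge0 ?(ltW s0) ?(ltW d0)//.
apply: ge0_ler_powR;
  rewrite ?nnegrE ?mulr_ge0 ?expR_ge0 ?invr_ge0 ?(ltW s0) ?(ltW d0)//.
have -> : x = s / d * (d * x / s) by field; rewrite !gt_eqF.
rewrite ler_wpM2l ?divr_ge0 ?(ltW s0) ?(ltW d0)//.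
rewrite [in leRHS](_ : d * (s / d * (d * x / s)) / s = d * x / s).
  by rewrite (le_trans _ (expR_ge1Dx _))// lerDr.
by field; rewrite !gt_eqF.
Qed.

Lemma cvgy_powR_expRM s c : 0 < s -> 0 < c ->
  x `^ s * expR (- (c * x)) @[x --> +oo] --> 0.
Proof.
move=> s0 c0; have c20 : 0 < c / 2 by rewrite divr_gt0.
apply: (@squeeze_cvgr _ _ _ _ (fun=> 0)
  (fun x => (s / (c / 2)) `^ s * expR (- (c / 2 * x)))); last 2 first.
- exact: cvg_cst.
- rewrite -[X in _ --> X](mulr0 ((s / (c / 2)) `^ s)); apply: cvgMr.
  exact: cvgy_expRM.
near=> x; rewrite mulr_ge0 ?powR_ge0 ?expR_ge0//=.
rewrite [c in leLHS](_ : _ = c / 2 + c / 2); last by field.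
rewrite mulrDl opprD expRD mulrA ler_wpM2r ?expR_ge0//.
rewrite expRN ler_pdivrMr ?expR_gt0//; apply: powR_le_expR => //.
Unshelve. end_near. Qed.

Lemma cvg0_powR_expRM s c : 0 < s -> x `^ s * expR (- (c * x)) @[x --> 0^'+] --> 0.
Proof.
move=> s0; rewrite -[X in _ --> X](mul0r (expR (- (c * 0)))); apply: cvgM.
  exact: powR_cvg0.
by apply: cvg_at_right_filter; apply: continuous_expRM.
Qed.

Lemma measurable_euler_kernel s c : measurable_fun (`]0, +oo[%classic : set R) (euler_kernel s c).
Proof.
apply: open_continuous_measurable_fun => //.
by move=> x; rewrite inE; exact: continuous_euler_kernel.
Qed.

Lemma measurable_expRM c : measurable_fun (`]0, +oo[%classic : set R) (fun x => expR (- (c * x))).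
Proof.
apply: measurable_funTS; apply: continuous_measurable_fun.
exact: continuous_expRM.
Qed.

Lemma integral_expRM c : 0 < c ->
  (\int[mu]_(x in `]0%R, +oo[) (c * expR (- (c * x)))%:E = 1)%E.
Proof.
move=> c0.
rewrite (@ge0_FTC_0y (fun x => c * expR (- (c * x))) (fun x => - expR (- (c * x))) (-1) 0).
- by rewrite sub0r opprK.
- by move=> x x0; rewrite mulr_ge0 ?expR_ge0 ?(ltW c0).
- move=> x x0; have dx := is_derive_expRM c x.
  by split; [exact: ex_derive|rewrite derive_val mulNr opprK].
- move=> x _; apply: cvgM; first exact: cvg_cst.
  exact: continuous_expRM.
- rewrite [X in _ --> X](_ : _ = - expR (- (c * 0))); last by rewrite mulr0 oppr0 expR0.
  apply: cvgN; apply: cvg_at_right_filter.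
  exact: continuous_expRM.
- by rewrite -oppr0; apply: cvgN; apply: cvgy_expRM.
Qed.

Lemma integrable_EFinZl (f : R -> R) k :
  mu.-integrable `]0, +oo[ (EFin \o f) ->
  mu.-integrable `]0, +oo[ (EFin \o (fun x => k * f x)).
Proof.
move=> fi; rewrite (_ : _ \o _ = (fun x => k%:E * (EFin \o f) x)%E).
  exact: integrableZl.
by apply/funext => x /=; rewrite EFinM.
Qed.

Lemma integrable_EFinB (f g : R -> R) :
  mu.-integrable `]0, +oo[ (EFin \o f) ->
  mu.-integrable `]0, +oo[ (EFin \o g) ->
  mu.-integrable `]0, +oo[ (EFin \o (fun x => f x - g x)).
Proof.
move=> fi gi; rewrite (_ : _ \o _ = ((EFin \o f) \- (EFin \o g))%E).
  exact: integrableB.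
by apply/funext => x /=; rewrite EFinB.
Qed.

Lemma integrable_expRM c : 0 < c ->
  mu.-integrable `]0, +oo[ (EFin \o (fun x => expR (- (c * x)))).
Proof.
move=> c0.
have ic : mu.-integrable `]0, +oo[ (EFin \o (fun x => c * expR (- (c * x)))).
  apply/integrableP; split.
    by apply/measurable_EFinP; apply: measurable_funM => //; exact: measurable_expRM.
  rewrite (_ : (\int[mu]_(x in _) _)%E = 1%E) ?ltry//.
  rewrite -(integral_expRM c0); apply: eq_integral => x _.
  by rewrite gee0_abs// lee_fin mulr_ge0 ?expR_ge0 ?(ltW c0).
have := integrable_EFinZl c^-1 ic.
by apply: eq_integrable => // x _ /=; rewrite mulKf// gt_eqF.
Qed.

(** For s > 0 the function x^s e^(- c x) / s - K e^(- c x / 2) has derivative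
    x^(s - 1) e^(- c x) plus a tail, and K is chosen to make the tail
    nonnegative.  Integrating this one derivative over the half-line bounds
    Euler's integral and, read as an equation, gives Gamma(s + 1) = s Gamma(s). *)
Definition majorant_mass s c : R := 2 / s * (s / (c / 2)) `^ s.

Definition majorant_tail s c x : R :=
  majorant_mass s c * (c / 2 * expR (- (c / 2 * x))) - c / s * euler_kernel (s + 1) c x.

Lemma majorant_tail_ge0 s c x : 0 < s -> 0 < c -> 0 <= x -> 0 <= majorant_tail s c x.
Proof.
move=> s0 c0 x0; have c20 : 0 < c / 2 by rewrite divr_gt0.
rewrite subr_ge0 /euler_kernel addrK /majorant_mass.
have -> : 2 / s * (s / (c / 2)) `^ s * (c / 2 * expR (- (c / 2 * x))) =
  c / s * ((s / (c / 2)) `^ s * expR (- (c / 2 * x))) by field; rewrite gt_eqF.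
rewrite ler_wpM2l ?divr_ge0 ?(ltW s0) ?(ltW c0)//.
rewrite [c in leLHS](_ : _ = c / 2 + c / 2); last by field.
rewrite mulrDl opprD expRD mulrA ler_wpM2r ?expR_ge0//.
by rewrite expRN ler_pdivrMr ?expR_gt0//; apply: powR_le_expR.
Qed.

Lemma integral_majorant s c : 0 < s -> 0 < c ->
  (\int[mu]_(x in `]0%R, +oo[) (euler_kernel s c x + majorant_tail s c x)%:E =
   (majorant_mass s c)%:E)%E.
Proof.
move=> s0 c0; have c20 : 0 < c / 2 by rewrite divr_gt0.
set K := majorant_mass s c.
rewrite (@ge0_FTC_0y (fun x => euler_kernel s c x + majorant_tail s c x)
  (fun x => s^-1 * (x `^ s * expR (- (c * x))) - K * expR (- (c / 2 * x)))
  (s^-1 * 0 - K * expR (- (c / 2 * 0))) (s^-1 * 0 - K * 0)).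
- by rewrite !(mulr0, oppr0, expR0, addr0, sub0r, opprK, mulr1).
- by move=> x x0; rewrite addr_ge0 ?euler_kernel_ge0 ?majorant_tail_ge0 ?(ltW x0).
- move=> x x0; have dx := is_derive_expRM (c / 2) x.
  have dy := is_derive_powR_expRM s c x0.
  split; first exact: ex_derive.
  by rewrite derive_val /majorant_tail -/K /GRing.scale /=; field; rewrite gt_eqF.
- move=> x x0; apply: cvgD; first exact: continuous_euler_kernel.
  apply: cvgB; last first.
    by apply: cvgM; [exact: cvg_cst|exact: continuous_euler_kernel].
  do 2 (apply: cvgM; first exact: cvg_cst).
  exact: continuous_expRM.
- apply: cvgB; apply: cvgMr; first exact: cvg0_powR_expRM.
  by apply: cvg_at_right_filter; exact: continuous_expRM.
- apply: cvgB; apply: cvgMr; first exact: cvgy_powR_expRM.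
  exact: cvgy_expRM.
Qed.

Lemma integrable_euler_kernel s c : 0 < s -> 0 < c ->
  mu.-integrable `]0, +oo[ (EFin \o euler_kernel s c).
Proof.
move=> s0 c0; pose h x := euler_kernel s c x + majorant_tail s c x.
have h0 x : `]0, +oo[%classic x -> 0 <= h x.
  rewrite /= in_itv /= andbT => x0.
  by rewrite addr_ge0 ?euler_kernel_ge0 ?majorant_tail_ge0 ?(ltW x0).
apply: (@le_integrable _ _ _ mu _ _ _ (EFin \o h)) => //.
- by apply/measurable_EFinP; exact: measurable_euler_kernel.
- move=> x /= x0; rewrite lee_fin !ger0_norm ?euler_kernel_ge0 ?h0//.
  rewrite lerDl majorant_tail_ge0//.
  by move: x0; rewrite /= in_itv /= andbT => /ltW.
- apply/integrableP; split.
    apply/measurable_EFinP/measurable_funD; first exact: measurable_euler_kernel.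
    apply: measurable_funB; apply: measurable_funM => //; last exact: measurable_euler_kernel.
    by apply: measurable_funM => //; exact: measurable_expRM.
  rewrite (_ : (\int[mu]_(x in _) _)%E = (majorant_mass s c)%:E) ?ltry//.
  rewrite -integral_majorant//; apply: eq_integral => x; rewrite inE => x0.
  by rewrite gee0_abs// lee_fin h0.
Qed.

Lemma Rintegral_expRM c : 0 < c -> \int[mu]_(x in `]0, +oo[) expR (- (c * x)) = c^-1.
Proof.
move=> c0; apply: (mulfI (lt0r_neq0 c0)); rewrite mulfV ?gt_eqF//.
rewrite -RintegralZl//; last exact: integrable_expRM.
by rewrite /Rintegral integral_expRM.
Qed.

(** The bound of [integral_majorant] split into its three summands; its mass K
    cancels against that of the exponential term. *)
Lemma Rintegral_euler_kernelS s c : 0 < s -> 0 < c ->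
  \int[mu]_(x in `]0, +oo[) euler_kernel (s + 1) c x =
  s / c * \int[mu]_(x in `]0, +oo[) euler_kernel s c x.
Proof.
move=> s0 c0; have c20 : 0 < c / 2 by rewrite divr_gt0.
have s1 : 0 < s + 1 by rewrite addr_gt0.
have := congr1 fine (integral_majorant s0 c0).
rewrite -/(Rintegral mu _ _) /=.
have i1 := integrable_euler_kernel s0 c0.
have i2 := integrable_euler_kernel s1 c0.
have i3 := integrable_expRM c20.
rewrite RintegralD; [|exact: measurable_itv|exact: i1|]; last first.
  apply: integrable_EFinB; do ?apply: integrable_EFinZl; [exact: i3|exact: i2].
rewrite RintegralB; [|exact: measurable_itv|..]; last 2 first.
  - by do 2 apply: integrable_EFinZl; exact: i3.
  - by apply: integrable_EFinZl; exact: i2.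
rewrite RintegralZl; [|exact: measurable_itv|by apply: integrable_EFinZl; exact: i3].
rewrite !RintegralZl; [|exact: measurable_itv|exact: i2|exact: measurable_itv|exact: i3].
rewrite Rintegral_expRM// mulfV ?gt_eqF// mulr1.
set I := Rintegral _ _ _; set I' := Rintegral _ _ _ => eI.
have {eI} -> : I = c / s * I' by lra.
by field; rewrite !gt_eqF.
Qed.

Lemma GammaE s : Gamma s = \int[mu]_(x in `]0, +oo[) euler_kernel s 1 x.
Proof. by apply: eq_Rintegral => x _; rewrite /euler_kernel mul1r. Qed.

Lemma GammaS s : 0 < s -> Gamma (s + 1) = s * Gamma s.
Proof. by move=> s0; rewrite !GammaE Rintegral_euler_kernelS// divr1. Qed.

Lemma Gamma_ge0 s : 0 <= Gamma s.
Proof. by rewrite GammaE; apply: Rintegral_ge0 => x _; exact: euler_kernel_ge0. Qed.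

(** The substitution x -> c x needs an integrand continuous at 0, hence s > 1;
    the recurrence in s removes this restriction. *)
Let Rintegral_euler_kernel_scale_gt1 s c : 1 < s -> 0 < c ->
  \int[mu]_(x in `]0, +oo[) euler_kernel s c x = Gamma s / c `^ s.
Proof.
move=> s1 c0; have s0 : 0 < s by apply: lt_trans s1.
have cs0 : 0 < c `^ s by rewrite powR_gt0.
apply: (mulfI (lt0r_neq0 cs0)); rewrite mulrCA divff ?gt_eqF// mulr1.
rewrite GammaE -RintegralZl//; last exact: integrable_euler_kernel.
rewrite /Rintegral; congr fine.
rewrite !integral_itv_obnd_cbnd; last 2 first.
- by apply/measurable_EFinP; exact: measurable_euler_kernel.
- by apply/measurable_EFinP/measurable_funM => //; exact: measurable_euler_kernel.
have c'E : ((fun x : R => c * x)^`())%classic = cst c.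
  apply/funext => x; rewrite derive1E derive_val /GRing.scale /=; ring.
have := @increasing_ge0_integration_by_substitutiony R (fun x => c * x) (euler_kernel s 1) 0.
rewrite mulr0 => ->.
- apply: eq_integral => x; rewrite inE /= in_itv /= andbT => x0; congr EFin.
  rewrite fctE c'E /= /euler_kernel mul1r powRM// ?(ltW c0)//.
  by rewrite -(mulr_powRB1 (ltW c0) s0); ring.
- by move=> x y _ _ xy; rewrite ltr_pM2l.
- by rewrite c'E => x _; exact: cvg_cst.
- by rewrite c'E; exact: is_cvg_cst.
- by rewrite c'E; exact: is_cvg_cst.
- split; first by move=> x _; exact: ex_derive.
  by rewrite mulr0 -[X in _ --> X](mulr0 c); apply: cvgMr; exact: cvg_at_right_filter.
- exact: gt0_cvgMry.
- apply/continuous_within_itvcyP; split; first exact: continuous_euler_kernel.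
  rewrite [X in _ --> X](_ : _ = 0).
    by apply: cvg0_powR_expRM; rewrite subr_gt0.
  by rewrite /euler_kernel powR0 ?mul0r// gt_eqF// subr_gt0.
- by move=> x _; exact: euler_kernel_ge0.
Qed.

Lemma Rintegral_euler_kernel s c : 0 < s -> 0 < c ->
  \int[mu]_(x in `]0, +oo[) euler_kernel s c x = Gamma s / c `^ s.
Proof.
move=> s0 c0; have sc0 : s / c != 0 by rewrite gt_eqF// divr_gt0.
apply: (mulfI sc0); rewrite -Rintegral_euler_kernelS// Rintegral_euler_kernel_scale_gt1 ?ltrDr//.
rewrite GammaS// powRD; last by rewrite (gt_eqF c0) implybT.
by rewrite powRr1 ?ltW//; field; rewrite !gt_eqF// powR_gt0.
Qed.

Lemma Gamma1 : Gamma 1 = 1 :> R.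
Proof.
rewrite -[RHS]invr1 -(Rintegral_expRM ltr01) GammaE.
by apply: eq_Rintegral => x _; rewrite /euler_kernel subrr powRr0 mul1r.
Qed.

Lemma Gamma_natS k : Gamma k.+1%:R = k`!%:R :> R.
Proof.
elim: k => [|k IH]; first by rewrite Gamma1.
by rewrite -natr1 GammaS ?ltr0n// IH factS natrM.
Qed.

(** The right-hand side is x^a times
    (1 - a) x^(- a) + a x^(1 - a), and e^u >= 1 + u bounds this last factor
    below by 1. *)
Lemma powR_le_tangent a x : 0 <= a <= 1 -> 0 < x -> x `^ a <= 1 - a + a * x.
Proof.
move=> /andP[a0 a1] x0; rewrite /powR gt_eqF//.
rewrite -[x in leRHS]lnK ?posrE//; set L := ln x.
have -> : 1 - a + a * expR L = expR (a * L) *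
    ((1 - a) * expR (- (a * L)) + a * expR ((1 - a) * L)).
  rewrite mulrDr !mulrA ![expR _ * _]mulrC -!mulrA -!expRD subrr expR0 mulr1.
  by congr (_ + a * expR _); ring.
rewrite ler_peMr ?expR_ge0//.
have e1 := expR_ge1Dx (- (a * L)); have e2 := expR_ge1Dx ((1 - a) * L).
rewrite -subr_ge0 in a1.
have := lerD (ler_wpM2l a1 e1) (ler_wpM2l a0 e2); apply: le_trans.
by rewrite le_eqVlt; apply/orP; left; apply/eqP; ring.
Qed.

(** The tangent inequality at x / z bounds x^a by an affine function of x, whose
    integral against x^(z - 1) e^(- x) is explicit. *)
Lemma Gamma_le z a : 0 < z -> 0 <= a <= 1 -> Gamma (z + a) <= z `^ a * Gamma z.
Proof.
move=> z0 a01; have /andP[a0 a1] := a01.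
have -> : z `^ a * Gamma z = \int[mu]_(x in `]0, +oo[)
    (z `^ a * (1 - a) * euler_kernel z 1 x + z `^ a * (a / z) * euler_kernel (z + 1) 1 x).
  have i1 := integrable_euler_kernel z0 ltr01.
  have i2 : mu.-integrable `]0, +oo[ (EFin \o euler_kernel (z + 1) 1).
    by apply: integrable_euler_kernel => //; rewrite addr_gt0.
  rewrite RintegralD; [|exact: measurable_itv|by apply: integrable_EFinZl; exact: i1
    |by apply: integrable_EFinZl; exact: i2].
  rewrite !RintegralZl; [|exact: measurable_itv|exact: i2|exact: measurable_itv|exact: i1].
  by rewrite Rintegral_euler_kernelS// divr1 -GammaE; field; rewrite gt_eqF.
have za0 : 0 < z + a by rewrite ltr_pwDl.
have i1 := integrable_euler_kernel za0 ltr01.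
rewrite GammaE; apply: le_Rintegral => //.
- have -> : (fun x => z `^ a * (1 - a) * euler_kernel z 1 x
        + z `^ a * (a / z) * euler_kernel (z + 1) 1 x)
    = (fun x => z `^ a * (1 - a) * euler_kernel z 1 x
        - (- (z `^ a * (a / z))) * euler_kernel (z + 1) 1 x).
    by apply/funext => x; ring.
  apply: integrable_EFinB; apply: integrable_EFinZl; apply: integrable_euler_kernel => //.
  by rewrite addr_gt0.
- move=> x; rewrite /= in_itv/= andbT => x0.
  have xz0 : 0 < x / z by rewrite divr_gt0.
  have -> : euler_kernel (z + a) 1 x = z `^ a * (x / z) `^ a * euler_kernel z 1 x.
    rewrite -powRM ?(ltW z0) ?(ltW xz0)// (mulrC z) divfK ?gt_eqF//.
    by rewrite /euler_kernel mulrA -powRD ?(gt_eqF x0) ?implybT//; congr (_ `^ _ * _); ring.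
  have -> : euler_kernel (z + 1) 1 x = x * euler_kernel z 1 x.
    by rewrite /euler_kernel addrK mulrA mulr_powRB1// ltW.
  have := powR_le_tangent a01 xz0.
  rewrite -(ler_pM2l (powR_gt0 a z0)) => /(ler_wpM2r (euler_kernel_ge0 z 1 x)) h.
  apply: (le_trans h); rewrite le_eqVlt; apply/orP; left; apply/eqP.
  by field; rewrite gt_eqF.
Qed.

(** A zero of Gamma at s would propagate by [Gamma_le] to the next integer,
    where Gamma is a factorial. *)
Lemma Gamma_gt0 s : 0 < s -> 0 < Gamma s.
Proof.
move=> s0; rewrite lt_neqAle Gamma_ge0 andbT; apply/eqP => Gs0.
(* The next integer is k + 1, and k + 1 - s lies in [0, 1]. *)
pose k := Num.truncn s.
have /andP[ks sk] : k%:R <= s < k.+1%:R by rewrite truncn_itv ?ltW.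
have h : 0 <= k.+1%:R - s <= 1.
  by rewrite subr_ge0 (ltW sk) lerBlDr -natr1 addrC lerD2l.
have := Gamma_le s0 h.
by rewrite -Gs0 mulr0 subrKC Gamma_natS leNgt ltr0n fact_gt0.
Qed.

Lemma cvgy_inv : t^-1 @[t --> (+oo : set_system R)] --> (0 : R).
Proof. by apply/gtr0_cvgV0; [exact: nbhs_pinfty_gt|exact: cvg_id]. Qed.

Lemma cvgy_affine_ratio (c a b : R) : c != 0 ->
  (c * t + a) / (c * t + b) @[t --> +oo] --> (1 : R).
Proof.
move=> c0.
have cvgD a' : c + a' * t^-1 @[t --> +oo] --> c.
  rewrite -[X in _ --> X]addr0; apply: cvgD; first exact: cvg_cst.
  by rewrite -(mulr0 a'); apply: cvgMr; exact: cvgy_inv.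
have : (c + a / t) / (c + b / t) @[t --> +oo] --> c / c.
  by apply: cvgM; [|apply: cvgV].
rewrite divff//; apply: cvg_trans; apply: near_eq_cvg; near=> t.
have t0 : t != 0 by rewrite gt_eqF//; near: t; exact: nbhs_pinfty_gt.
have e x : c + x / t = (c * t + x) / t by field.
by rewrite !e invf_div mulrA divfK.
Unshelve. all: by end_near. Qed.

(** The upper bound is [Gamma_le] at z; the lower one is [Gamma_le] at z + a
    with exponent 1 - a, which compares Gamma(z + 1) with Gamma(z + a). *)
Let Gamma_ratio01 a : 0 <= a <= 1 ->
  Gamma (z + a) / (Gamma z * z `^ a) @[z --> +oo] --> (1 : R).
Proof.
move=> a01; have /andP[a0 a1] := a01.
apply: (@squeeze_cvgr _ _ _ _ (fun z => (1 * z + 0) / (1 * z + a)) (fun=> 1)); last 2 first.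
- by apply: cvgy_affine_ratio; rewrite oner_eq0.
- exact: cvg_cst.
near=> z.
have z0 : 0 < z by near: z; apply: nbhs_pinfty_gt.
have za0 : 0 < z + a by rewrite ltr_pwDl.
have D0 : 0 < Gamma z * z `^ a by rewrite mulr_gt0 ?powR_gt0 ?Gamma_gt0.
apply/andP; split; last by rewrite ler_pdivrMr// mul1r mulrC Gamma_le.
have r01 : 0 < z / (z + a) <= 1.
  by rewrite divr_gt0// ler_pdivrMr// mul1r lerDl.
rewrite mul1r addr0.
apply: (@le_trans _ _ ((z / (z + a)) `^ (1 - a))).
  by apply: ger1_powR => //; rewrite gerBl.
rewrite ler_pdivlMr//.
have := @Gamma_le (z + a) (1 - a) za0.
rewrite subr_ge0 a1 gerBl a0 => /(_ isT).
rewrite (_ : z + a + (1 - a) = z + 1); last by ring.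
rewrite GammaS//.
have i0 : 0 < (z + a)^-1 by rewrite invr_gt0.
rewrite -(ler_pM2l (powR_gt0 (1 - a) i0)).
rewrite [X in _ <= X -> _]mulrA -powRM ?invr_ge0 ?(ltW za0)// mulVf ?gt_eqF// powR1 mul1r.
rewrite powRM ?invr_ge0 ?(ltW z0) ?(ltW za0)//.
apply: le_trans; rewrite le_eqVlt; apply/orP; left; apply/eqP.
have zE : z = z `^ (1 - a) * z `^ a.
  by rewrite -powRD ?(gt_eqF z0) ?implybT// subrK powRr1 ?ltW.
have -> : z * Gamma z = z `^ (1 - a) * z `^ a * Gamma z by rewrite -zE.
ring.
Unshelve. all: by end_near. Qed.

Lemma Gamma_ratio a : 0 <= a ->
  Gamma (z + a) / (Gamma z * z `^ a) @[z --> +oo] --> (1 : R).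
Proof.
move=> a0; have /andP[ka ak] := truncn_itv a0.
pose s := a - (Num.truncn a)%:R.
(* Reduction to the fractional part; each unit step contributes (z + a) / z. *)
have s01 : 0 <= s <= 1.
  by rewrite subr_ge0 ka lerBlDr addrC natr1 ltW.
have -> : a = s + (Num.truncn a)%:R by rewrite subrK.
clearbody s; move: (Num.truncn a) => k {ka ak a0 a}.
elim: k => [|k IH]; first by rewrite addr0; exact: Gamma_ratio01.
have /andP[s0 _] := s01.
have sk0 : 0 <= s + k%:R by rewrite addr_ge0 ?ler0n.
have : (1 * z + (s + k%:R)) / (1 * z + 0) *
    (Gamma (z + (s + k%:R)) / (Gamma z * z `^ (s + k%:R))) @[z --> +oo] --> (1 * 1 : R).
  by apply: cvgM; [apply: cvgy_affine_ratio; rewrite oner_eq0|exact: IH].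
rewrite mulr1; apply: cvg_trans; apply: near_eq_cvg; near=> z.
have z0 : 0 < z by near: z; apply: nbhs_pinfty_gt.
rewrite -natr1 !addrA GammaS; last by rewrite -addrA ltr_pwDl.
rewrite (_ : s + k%:R + 1 = 1 + (s + k%:R)); last by ring.
rewrite [in RHS]powRD ?(gt_eqF z0) ?implybT// powRr1 ?(ltW z0)//.
have Gz := Gamma_gt0 z0; have Pz := powR_gt0 (s + k%:R) z0.
by field; rewrite !gt_eqF.
Unshelve. all: by end_near. Qed.

End Gamma.

(** * Pochhammer symbols and truncated binomial series *)

Section Pochhammer.
Context {R : realType}.
Implicit Types (x y e : R) (k l m : nat).

Lemma poch0 x : poch x 0 = 1.
Proof. by rewrite /poch big_ord0. Qed.

Lemma pochSr x k : poch x k.+1 = poch x k * (x + k%:R).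
Proof. by rewrite /poch big_ord_recr. Qed.

Lemma pochD x k l : poch x (k + l) = poch x k * poch (x + k%:R) l.
Proof.
elim: l => [|l IH]; first by rewrite addn0 poch0 mulr1.
by rewrite addnS !pochSr IH natrD addrA mulrA.
Qed.

Lemma pochSl x k : poch x k.+1 = x * poch (x + 1) k.
Proof. by rewrite -add1n pochD pochSr poch0 mul1r addr0. Qed.

Lemma poch_gt0 x k : 0 < x -> 0 < poch x k.
Proof. by move=> x0; apply: prodr_gt0 => j _; rewrite ltr_pwDl. Qed.

Lemma poch_neq0 x k : 0 < x -> poch x k != 0.
Proof. by move=> x0; rewrite gt_eqF ?poch_gt0. Qed.

Lemma poch0_eq0 k : poch (0 : R) k = (k == 0%N)%:R.
Proof. by case: k => [|k]; rewrite ?poch0// pochSl mul0r. Qed.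

Lemma poch_oneE k : poch (1 : R) k = k`!%:R.
Proof.
elim: k => [|k IH]; first by rewrite poch0.
by rewrite pochSr IH factS natrM mulrC nat1r.
Qed.

(** The left-hand side is the falling factorial b (b - 1) ... (b - j + 1). *)
Lemma poch_reflect (b : R) j : poch (b + 1 - j%:R) j = (-1) ^+ j * poch (- b) j.
Proof.
rewrite /poch -[in (-1) ^+ j](card_ord j) -prodr_const -big_split /=.
rewrite (reindex_inj rev_ord_inj) /=; apply: eq_bigr => k _.
rewrite natrB//; ring.
Qed.

Lemma poch_oppn m k : (k <= m)%N ->
  poch (- m%:R) k = (-1) ^+ k * (m`!%:R / (m - k)`!%:R) :> R.
Proof.
elim: k => [|k IH] km; first by rewrite poch0 subn0 mul1r divff// pnatr_eq0 -lt0n fact_gt0.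
rewrite pochSr IH ?(ltnW km)//.
have -> : (m - k)%N = (m - k.+1).+1 by lia.
rewrite factS natrM exprS.
have f0 : (m - k.+1)`!%:R != 0 :> R by rewrite pnatr_eq0 -lt0n fact_gt0.
have d0 : (m - k.+1).+1%:R != 0 :> R by rewrite pnatr_eq0.
have -> : - m%:R + k%:R = - (m - k.+1).+1%:R :> R.
  by rewrite subnSK// natrB ?(ltnW km)//; ring.
by field; rewrite f0 nat1r d0.
Qed.

Lemma poch_oppn_eq0 m k : (m < k)%N -> poch (- m%:R : R) k = 0.
Proof.
by move=> mk; rewrite -(subnKC mk) pochD pochSr addNr mulr0 mul0r.
Qed.

(** Both sides are the coefficient of u^k in (1 - u)^(- x - y).  With p_j the
    coefficients of (1 - u)^(- x), one has (j + 1) p_(j + 1) = (x + j) p_j, and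
    splitting k + 1 = j + (k + 1 - j) in the convolution yields the same
    recurrence for it, with x + y in place of x. *)
Lemma poch_Vandermonde x y k :
  \sum_(j < k.+1) poch x j / j`!%:R * (poch y (k - j) / (k - j)`!%:R) =
  poch (x + y) k / k`!%:R.
Proof.
have f0 j : j`!%:R != 0 :> R by rewrite pnatr_eq0 -lt0n fact_gt0.
have step (z : R) j : j.+1%:R * (poch z j.+1 / j.+1`!%:R) = (z + j%:R) * (poch z j / j`!%:R).
  rewrite pochSr factS natrM; field.
  by rewrite f0 nat1r pnatr_eq0.
elim: k => [|k IH].
  by rewrite big_ord_recl big_ord0 subn0 !poch0 fact0 divr1 mulr1 addr0.
have k0 : k.+1%:R != 0 :> R by rewrite pnatr_eq0.
apply: (mulfI k0); rewrite step -IH !mulr_sumr.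
pose F j := poch x j / j`!%:R * (poch y (k.+1 - j) / (k.+1 - j)`!%:R) : R.
transitivity (\sum_(j < k.+2) (j%:R * F j + (k.+1 - j)%:R * F j)).
  apply: eq_bigr => j _; rewrite -mulrDl -natrD subnKC//.
  by rewrite -ltnS.
rewrite big_split /= big_ord_recl /= mul0r add0r.
rewrite [X in _ + X]big_ord_recr /= subnn mul0r addr0 -big_split /=.
apply: eq_bigr => j _; rewrite /bump leq0n add1n /F subSS mulrA step.
have jk : (j <= k)%N by rewrite -ltnS.
rewrite subSn// (mulrCA (k - j).+1%:R) step natrB//; ring.
Qed.

End Pochhammer.

Section Truncated.
Context {R : realType}.
Implicit Types (x y e : R) (P Q S T : {poly R}) (M k : nat).

Definition eqmodXn M P Q := forall k, (k < M)%N -> P`_k = Q`_k.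

Lemma eqmodXn_sym M P Q : eqmodXn M P Q -> eqmodXn M Q P.
Proof. by move=> h k kM; rewrite h. Qed.

Lemma eqmodXn_trans M P Q S : eqmodXn M P Q -> eqmodXn M Q S -> eqmodXn M P S.
Proof. by move=> h h' k kM; rewrite h// h'. Qed.

Lemma eqmodXnM M P Q S T :
  eqmodXn M P Q -> eqmodXn M S T -> eqmodXn M (P * S) (Q * T).
Proof.
move=> h h' k kM; rewrite !coefM; apply: eq_bigr => j _.
by rewrite h ?h'//; have := ltn_ord j; lia.
Qed.

Lemma eqmodXnMl M P Q S : eqmodXn M P Q -> eqmodXn M (S * P) (S * Q).
Proof. by move=> h; apply: eqmodXnM. Qed.

Lemma eqmodXnMr M P Q S : eqmodXn M P Q -> eqmodXn M (P * S) (Q * S).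
Proof. by move=> h; apply: eqmodXnM. Qed.

Lemma eqmodXn_prod M (I : finType) (A : pred I) (F G : I -> {poly R}) :
  (forall q, A q -> eqmodXn M (F q) (G q)) ->
  eqmodXn M (\prod_(q | A q) F q) (\prod_(q | A q) G q).
Proof. by move=> h; elim/big_rec2: _ => // q P Q Aq; apply: eqmodXnM; exact: h. Qed.

Definition exp_series M y : {poly R} := \poly_(k < M) (y ^+ k / k`!%:R).

(** The first [M] terms of the binomial series of (1 - e u)^(-y). *)
Definition binser M y e : {poly R} := \poly_(k < M) (poch y k / k`!%:R * e ^+ k).

Lemma binserD M x y e :
  eqmodXn M (binser M x e * binser M y e) (binser M (x + y) e).
Proof.
move=> k kM; rewrite coefM coef_poly kM -poch_Vandermonde mulr_suml.
apply: eq_bigr => j _; rewrite !coef_poly.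
have jk : (j <= k)%N by rewrite -ltnS.
rewrite (leq_ltn_trans jk kM) (leq_ltn_trans (leq_subr _ _) kM).
by rewrite -[in e ^+ k](subnKC jk) exprD; ring.
Qed.

Lemma binser0 M e : eqmodXn M (binser M 0 e) 1.
Proof.
move=> k kM; rewrite coef_poly kM poch0_eq0 coef1.
by case: eqP => [->|]; rewrite ?mul0r// fact0 divr1 mulr1.
Qed.

Lemma binserN1 M e : eqmodXn M (binser M (- 1) e) (1 - e *: 'X).
Proof.
move=> k kM; rewrite coef_poly kM coefB coef1 coefZ coefX.
case: k kM => [|[|k]] kM; first by rewrite poch0 fact0 divr1 mulr1 mulr0 subr0.
  by rewrite pochSr poch0 (_ : 1`! = 1%N)// divr1 expr1 addr0 mul1r mulr1 sub0r mulN1r.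
by rewrite !pochSl addNr mul0r mulr0 !mul0r mulr0 subr0.
Qed.

Lemma binserNn M n e : eqmodXn M (binser M (- n%:R) e) ((1 - e *: 'X) ^+ n).
Proof.
elim: n => [|n IH]; first by rewrite oppr0 expr0; exact: binser0.
rewrite -natr1 opprD exprSr; apply: eqmodXn_trans.
  by apply: eqmodXn_sym; exact: binserD.
by apply: eqmodXnM => //; exact: binserN1.
Qed.

(** Multiplication by 1 / (1 - u) forms partial sums of coefficients. *)
Lemma coef_binser1M M P k : (k < M)%N ->
  (binser M 1 1 * P)`_k = \sum_(j < k.+1) P`_j.
Proof.
move=> kM; rewrite coefMr; apply: eq_bigr => j _; rewrite coef_poly.
rewrite (leq_ltn_trans (leq_subr _ _) kM) poch_oneE divff ?pnatr_eq0 -?lt0n ?fact_gt0//.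
by rewrite expr1n !mul1r.
Qed.

(** This is (-1)^k c^a times the k-th derivative at s = c of
    sum_j r_j s^(- a - j), which is, up to the factor Gamma(a), the Laplace
    transform of x^(a - 1) sum_j r_j x^j / (a)_j. *)
Definition laplace_moment (a c : R) (r : nat -> R) (N k : nat) : R :=
  \sum_(j < N) r j * poch (a + j%:R) k / c ^+ (j + k).

(** With s = c (1 - u), sum_j r_j s^(- a - j) is s^(- a - N + 1) G(s), so its
    Taylor coefficients at c are, up to powers of c, the coefficients of
    (1 - u)^(- a - N + 1) G(c (1 - u)). *)
Lemma laplace_momentE (a c : R) (G : {poly R}) (N k M : nat) : c != 0 -> (0 < N)%N ->
  (size G <= N)%N -> (k < M)%N ->
  laplace_moment a c (fun j => G`_(N.-1 - j)) N k =
  k`!%:R / c ^+ (N.-1 + k) *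
  (binser M (a + N.-1%:R) 1 * (G \Po (c *: (1 - 'X))))`_k.
Proof.
move=> c0; case: N => // N _ sG kM /=.
have k0 : k`!%:R != 0 :> R by rewrite pnatr_eq0 -lt0n fact_gt0.
have -> : G \Po (c *: (1 - 'X)) =
    \sum_(j < N.+1) (G`_(N - j) * c ^+ (N - j)) *: (1 - 1 *: 'X) ^+ (N - j).
  rewrite comp_polyE (big_ord_widen N.+1 (fun j => G`_j *: (c *: (1 - 'X)) ^+ j))//.
  rewrite big_mkcond /= (reindex_inj rev_ord_inj) /=; apply: eq_bigr => j _.
  rewrite subSS scale1r; case: ltnP => [_|h]; first by rewrite exprZn scalerA.
  by rewrite nth_default// mul0r scale0r.
rewrite mulr_sumr coef_sum mulr_sumr; apply: eq_bigr => j _.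
have jN : (j <= N)%N by rewrite -ltnS.
have e : eqmodXn M (binser M (a + N%:R) 1 * (1 - 1 *: 'X) ^+ (N - j))
    (binser M (a + j%:R) 1).
  apply: eqmodXn_trans; first by apply: eqmodXnMl; apply: eqmodXn_sym; exact: binserNn.
  apply: eqmodXn_trans; first exact: binserD.
  by rewrite (_ : a + N%:R - (N - j)%:R = a + j%:R)// natrB//; ring.
rewrite -scalerAr coefZ e// coef_poly kM expr1n mulr1.
have -> : c ^+ (N + k) = c ^+ (N - j) * c ^+ (j + k) by rewrite -exprD addnA subnK.
by field; rewrite k0 !expf_neq0.
Qed.

End Truncated.

(** * Isolating one coefficient of a type I family *)

Section CoefIsolation.
Context {R : realType} {p : nat}.
Variables (n : 'I_p -> nat) (c : 'I_p -> R) (alpha0 : R) (i : 'I_p).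
Hypotheses (halpha0 : -1 < alpha0) (hc : forall q, 0 < c q) (hinj : injective c).
Hypothesis hni : (1 <= n i)%N.

Local Notation N := (mabs n).
Let a : R := alpha0 + 1.

Lemma mabs_gt0 : (0 < N)%N.
Proof. by rewrite (leq_trans hni)// /mabs (bigD1 i)//= leq_addr. Qed.

Definition pole_series M : {poly R} :=
  \prod_(q < p | q != i) binser M (n q)%:R (c i / (c i - c q)).

(** The series W(u) at x = 0: (1 - u)^b times the factors of [pole_series]. *)
Definition weight_series M : {poly R} := binser M (- (alpha0 + N%:R - 1)) 1 * pole_series M.

(** The test polynomial is prod_(q != i) (c_q - s)^(n_q) times this polynomial in
    u = 1 - s / c_i, up to a constant.  The product of all that with
    s^(- alpha0 - N) has to be a multiple of u^k0 to order n_i, so it is a Taylor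
    polynomial of u^k0 divided by the other factors. *)
Let taylor_part k0 : {poly R} :=
  take_poly (n i) ('X^k0 * (binser (n i) (- (alpha0 + N%:R)) 1 * pole_series (n i))).

Let test_cst := \prod_(q < p | q != i) (c q - c i) ^- n q.
Let test_prod : {poly R} := \prod_(q < p | q != i) ((c q)%:P - 'X) ^+ n q.
Let test_poly k0 := test_prod * (test_cst *: (taylor_part k0 \Po (1 - (c i)^-1 *: 'X))).

Lemma size_prod_exp_leq (I : finType) (A : pred I) (F : I -> {poly R}) (e : I -> nat) :
  (forall q, (size (F q) <= 2)%N) ->
  (size (\prod_(q | A q) F q ^+ e q)%R <= (\sum_(q | A q) e q).+1)%N.
Proof.
move=> sF; elim/big_rec2: _ => [|q P s _ sP]; first by rewrite size_poly1.
apply: (leq_trans (size_polyMleq _ _)).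
have h : (size (F q ^+ e q) <= (e q).+1)%N.
  apply: (leq_trans (size_poly_exp_leq _ _)); rewrite ltnS.
  by have := sF q; case: (size _) => [|[|[|]]]//= _; lia.
by lia.
Qed.

Let size_test_poly k0 : (size (test_poly k0) <= N)%N.
Proof.
apply: (leq_trans (size_polyMleq _ _)).
have h1 : (size test_prod <= (\sum_(q < p | q != i) n q).+1)%N.
  apply: size_prod_exp_leq => q; apply: (leq_trans (size_polyD _ _)).
  by rewrite geq_max size_polyN size_polyX (leq_trans (size_polyC_leq1 _)).
have h2 : (size (test_cst *: (taylor_part k0 \Po (1 - (c i)^-1 *: 'X)))%R <= n i)%N.
  apply: (leq_trans (size_scale_leq _ _)).
  apply: (leq_trans (size_comp_poly_leq _ _)).
  have s1 : (size (taylor_part k0) <= n i)%N by exact: size_take_poly.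
  have s2 : (size (1 - (c i)^-1 *: 'X : {poly R})%R <= 2)%N.
    apply: (leq_trans (size_polyD _ _)); rewrite geq_max size_poly1 size_polyN.
    by rewrite (leq_trans (size_scale_leq _ _))// size_polyX.
  move: s1 s2; set u := size _; set v := size _ => s1 s2.
  have : (u.-1 * v.-1 <= (n i).-1 * 1)%N by apply: leq_mul; lia.
  by move: hni; lia.
rewrite /mabs (bigD1 i)//=; move: h1 h2.
by set u := size _; set v := size _; move: (\sum_(_ < p | _) _)%N; lia.
Qed.

Let cq0 q : c q != 0. Proof. by rewrite gt_eqF. Qed.
Let cB q : q != i -> c q - c i != 0.
Proof. by move=> qi; rewrite subr_eq0; apply: contra_neq qi => /hinj. Qed.

Let test_prod_comp q : test_prod \Po (c q *: (1 - 'X)) =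
  \prod_(r < p | r != i) ((c r - c q)%:P + c q *: 'X) ^+ n r.
Proof.
rewrite /test_prod rmorph_prod; apply: eq_bigr => r _.
rewrite rmorphXn /= comp_polyB comp_polyC comp_polyX.
by congr (_ ^+ _); rewrite scalerBr polyCB opprB alg_polyC; ring.
Qed.

(** The factor (c_q - s)^(n_q) of the test polynomial is a multiple of u^(n_q)
    when s = c_q (1 - u). *)
Let moment_other k0 q k M y : q != i -> (k < n q)%N ->
  (binser M y 1 * (test_poly k0 \Po (c q *: (1 - 'X))))`_k = 0.
Proof.
move=> qi kn; rewrite comp_polyM test_prod_comp (bigD1 q)//= subrr polyC0 add0r.
by rewrite exprZn mulrCA -!mulrA -scalerAl mulrA coefZ coefXnM kn mulr0.
Qed.

Let moment_self k0 : eqmodXn (n i)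
  (binser (n i) (alpha0 + N%:R) 1 * (test_poly k0 \Po (c i *: (1 - 'X)))) 'X^k0.
Proof.
rewrite comp_polyM test_prod_comp linearZ /= -comp_polyA comp_polyB comp_polyZ comp_polyX.
rewrite comp_polyC scalerA mulVf// scale1r opprB subrKC comp_polyXr.
pose Q := \prod_(r < p | r != i) (1 - (c i / (c i - c r)) *: 'X : {poly R}) ^+ n r.
pose Q' := \prod_(r < p | r != i) binser (n i) (- (n r)%:R) (c i / (c i - c r)).
set T := taylor_part k0.
have -> : \prod_(r < p | r != i) ((c r - c i)%:P + c i *: 'X) ^+ n r * (test_cst *: T) = Q * T.
  have -> : \prod_(r < p | r != i) ((c r - c i)%:P + c i *: 'X) ^+ n r =
      (\prod_(r < p | r != i) (c r - c i) ^+ n r) *: Q.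
    rewrite /Q -scaler_prod; apply: eq_bigr => r ri; rewrite -exprZn; congr (_ ^+ _).
    rewrite scalerBr scalerA alg_polyC -scaleNr; congr (_ + _ *: _).
    by field; rewrite -opprB oppr_eq0 cB.
  rewrite -scalerAl -scalerAr scalerA -big_split /= big1 ?scale1r// => r ri.
  by rewrite mulfV// expf_neq0 ?cB.
have hT : eqmodXn (n i) T ('X^k0 * (binser (n i) (- (alpha0 + N%:R)) 1 * pole_series (n i))).
  by move=> k kn; rewrite coef_take_poly kn.
have hQ : eqmodXn (n i) Q Q'.
  by apply: eqmodXn_prod => r _; apply: eqmodXn_sym; exact: binserNn.
have hQH : eqmodXn (n i) (Q' * pole_series (n i)) 1.
  have one : \prod_(r < p | r != i) (1 : {poly R}) = 1 by rewrite big1_eq.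
  rewrite /Q' /pole_series -big_split /= -[X in eqmodXn _ _ X]one.
  apply: eqmodXn_prod => r _; apply: eqmodXn_trans; first exact: binserD.
  by rewrite addNr; exact: binser0.
apply: eqmodXn_trans.
  by apply: eqmodXnMl; apply: eqmodXnM; [exact: hQ|exact: hT].
set B := binser _ _ _; set B' := binser _ _ _.
have -> : B * (Q' * ('X^k0 * (B' * pole_series (n i)))) =
  'X^k0 * ((B * B') * (Q' * pole_series (n i))) by ring.
rewrite -[X in eqmodXn _ _ X](mulr1 'X^k0) -[X in eqmodXn _ _ (_ * X)](mulr1 1).
apply: eqmodXnMl; apply: eqmodXnM; last exact: hQH.
by apply: eqmodXn_trans; [exact: binserD|rewrite subrr; exact: binser0].
Qed.

(** The factor 1 / (1 - u) of partial summation lowers the exponent alpha0 + N of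
    1 - u to b. *)
Let taylor_part_at1 k0 : (k0 < n i)%N ->
  (taylor_part k0).[1] = (weight_series (n i))`_((n i).-1 - k0).
Proof.
move=> kn; set B := binser (n i) (- (alpha0 + N%:R)) 1 * pole_series (n i).
rewrite (@horner_coef_wide _ (n i)) ?size_take_poly//.
under eq_bigr => k _ do rewrite expr1n mulr1 coef_take_poly ltn_ord.
rewrite -[n i in LHS](prednK hni) -(@coef_binser1M _ (n i)); last by rewrite prednK.
rewrite mulrCA mulrC coefMXn ltnNge -ltnS prednK// kn /=.
rewrite ?/B mulrA; apply: (@eqmodXnMr _ (n i)); last by move: hni; lia.
apply: eqmodXn_trans; first exact: binserD.
by rewrite (_ : 1 - (alpha0 + N%:R) = - (alpha0 + N%:R - 1))//; ring.
Qed.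

Let test_poly0 k0 : (k0 < n i)%N -> (test_poly k0)`_0 =
  \prod_(q < p | q != i) (c q / (c q - c i)) ^+ n q * (weight_series (n i))`_((n i).-1 - k0).
Proof.
move=> kn; rewrite -horner_coef0 hornerM hornerZ horner_comp.
have -> : (1 - (c i)^-1 *: 'X : {poly R}).[0] = 1 by rewrite !hornerE ?mulr0 subr0.
rewrite taylor_part_at1// mulrA; congr (_ * _).
rewrite horner_prod -big_split /=; apply: eq_bigr => q _.
by rewrite !hornerE subr0 exprMn exprVn.
Qed.

(** The j-th orthogonality integral when [L q k] is the coefficient of x^k in the
    q-th polynomial. *)
Definition laguerre_moment (L : 'I_p -> nat -> R) (j : nat) : R :=
  \sum_(q < p) Gamma a / c q `^ a *
     \sum_(k < n q) L q k * (poch a (j + k) / c q ^+ (j + k)).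

(** The weights come from the test polynomial; the last of them is its value
    at 0, divided by (a)_(N - 1). *)
Lemma coef_isolation (k0 : nat) : (k0 < n i)%N ->
  exists2 w : nat -> R,
    w N.-1 = \prod_(q < p | q != i) (c q / (c q - c i)) ^+ n q
      * (weight_series (n i))`_((n i).-1 - k0) / poch a N.-1
  & forall L, \sum_(j < N) w j * laguerre_moment L j =
      L i k0 * (Gamma a / c i `^ a * (k0`!%:R / c i ^+ (N.-1 + k0))).
Proof.
move=> kn; have a0 : 0 < a by rewrite /a -ltrBlDr sub0r.
have N0 := mabs_gt0.
exists (fun j => (test_poly k0)`_(N.-1 - j) / poch a j); first by rewrite subnn test_poly0.
move=> L.
have -> : \sum_(j < N) (test_poly k0)`_(N.-1 - j) / poch a j * laguerre_moment L j =
    \sum_(q < p) Gamma a / c q `^ a *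
       \sum_(k < n q) L q k * laplace_moment a (c q) (fun j => (test_poly k0)`_(N.-1 - j)) N k.
  rewrite /laguerre_moment; under eq_bigr do rewrite mulr_sumr.
  rewrite exchange_big /=; apply: eq_bigr => q _.
  under eq_bigr do rewrite mulrCA mulr_sumr.
  rewrite -mulr_sumr; congr (_ * _); rewrite exchange_big /=; apply: eq_bigr => k _.
  rewrite /laplace_moment mulr_sumr; apply: eq_bigr => j _; rewrite pochD.
  by field; rewrite expf_neq0 ?cq0// poch_neq0.
rewrite (bigD1 i)//= [X in _ + X]big1 ?addr0; last first.
  move=> q qi; rewrite big1 ?mulr0// => k _.
  rewrite (@laplace_momentE _ _ _ _ _ _ (n q)) ?cq0 ?size_test_poly//.
  by rewrite moment_other// !mulr0.
have aE : a + N.-1%:R = alpha0 + N%:R.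
  by rewrite /a -[in RHS](prednK N0) -natr1; ring.
under eq_bigr => k _ do
  rewrite (@laplace_momentE _ _ _ _ _ _ (n i)) ?cq0 ?size_test_poly// aE moment_self// coefXn.
rewrite (bigD1 (Ordinal kn))//= eqxx mulr1 big1 ?addr0; first by ring.
by move=> k; rewrite -val_eqE /= => /negPf ->; rewrite !mulr0.
Qed.

End CoefIsolation.

(** * Existence, uniqueness and the generating function *)

(** For a square system uniqueness implies existence; the unknowns are indexed by
    an arbitrary finite type so that it applies to pairs (q, k) with k < n_q. *)
Lemma injective_system_solvable (F : fieldType) (T : finType) (N : nat)
    (M : T -> nat -> F) (y : nat -> F) : #|T| = N ->
  (forall v : T -> F, (forall j, (j < N)%N -> \sum_t v t * M t j = 0) ->
     forall t, v t = 0) ->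
  exists v : T -> F, forall j, (j < N)%N -> \sum_t v t * M t j = y j.
Proof.
move=> <- hM.
pose A := \matrix_(s < #|T|, j < #|T|) M (enum_val s) j.
have AE (v : 'rV_#|T|) (j : 'I_#|T|) :
    (v *m A) 0 j = \sum_t v 0 (enum_rank t) * M t j.
  rewrite mxE (reindex_onto enum_rank enum_val) /=; last by move=> s _; exact: enum_valK.
  by apply: eq_big => [t|t _]; rewrite ?enum_rankK ?eqxx// mxE enum_rankK.
have Aunit : A \in unitmx.
  rewrite -row_free_unit; apply: inj_row_free => v vA.
  apply/rowP => s; rewrite mxE -[s]enum_valK.
  apply: (hM (fun t => v 0 (enum_rank t))) => j jN.
  by rewrite -(AE v (Ordinal jN)) vA mxE.
exists (fun t => ((\row_j y (nat_of_ord j)) *m invmx A) 0 (enum_rank t)) => j jN.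
by rewrite -(AE _ (Ordinal jN)) mulmxKV// mxE.
Qed.

Section System.
Context {R : realType} {p : nat}.
Local Notation mu := (@lebesgue_measure R).

Lemma Gamma_poch (s : R) k : 0 < s -> Gamma (s + k%:R) = poch s k * Gamma s.
Proof.
move=> s0; elim: k => [|k IH]; first by rewrite addr0 poch0 mul1r.
rewrite -natr1 addrA GammaS ?ltr_pwDl// IH pochSr; ring.
Qed.

Lemma Rintegral_sum_euler_kernel (m : nat) (u s : nat -> R) (c : R) :
  0 < c -> (forall k, 0 < s k) ->
  mu.-integrable `]0, +oo[ (EFin \o (fun x => \sum_(k < m) u k * euler_kernel (s k) c x)) /\
  \int[mu]_(x in `]0, +oo[) (\sum_(k < m) u k * euler_kernel (s k) c x) =
  \sum_(k < m) u k * (Gamma (s k) / c `^ s k).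
Proof.
move=> c0 s0; elim: m => [|m [IHi IH]].
  split.
    rewrite (_ : _ \o _ = cst 0%E); first exact: integrable0.
    by apply/funext => x /=; rewrite big_ord0.
  rewrite big_ord0 (@eq_Rintegral _ _ _ _ _ (cst 0)) ?Rintegral_cst ?mul0r//.
  by move=> x _; rewrite big_ord0.
have ik := integrable_EFinZl (u m) (integrable_euler_kernel (s0 m) c0).
have e x : \sum_(k < m.+1) u k * euler_kernel (s k) c x =
    \sum_(k < m) u k * euler_kernel (s k) c x + u m * euler_kernel (s m) c x.
  by rewrite big_ord_recr.
split.
  pose f x := \sum_(k < m) u k * euler_kernel (s k) c x; pose g x := u m * euler_kernel (s m) c x.
  rewrite (_ : _ \o _ = ((EFin \o f) \+ (EFin \o g))%E); last first.
    by apply/funext => x /=; rewrite e EFinD.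
  exact: integrableD.
under eq_Rintegral do rewrite e.
rewrite RintegralD; [|exact: measurable_itv|exact: IHi|exact: ik].
rewrite IH RintegralZl; [|exact: measurable_itv|exact: integrable_euler_kernel].
by rewrite Rintegral_euler_kernel// big_ord_recr.
Qed.

Lemma Rintegral_poly_moment (L : {poly R}) (m j : nat) (alpha0 c : R) :
  -1 < alpha0 -> 0 < c -> (size L <= m)%N ->
  \int[mu]_(x in `]0, +oo[)
    (x ^+ j * L.[x] * (x `^ alpha0 * expR (- (c * x)))) =
  Gamma (alpha0 + 1) / c `^ (alpha0 + 1) *
    \sum_(k < m) L`_k * (poch (alpha0 + 1) (j + k) / c ^+ (j + k)).
Proof.
move=> ha c0 sL; have a0 : 0 < alpha0 + 1 by rewrite -ltrBlDr sub0r.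
pose s k : R := alpha0 + 1 + (j + k)%:R.
have s0 k : 0 < s k by rewrite ltr_pwDl.
transitivity (\int[mu]_(x in `]0, +oo[) (\sum_(k < m) L`_k * euler_kernel (s k) c x)).
  apply: eq_Rintegral => x; rewrite inE /= in_itv /= andbT => x0.
  rewrite (horner_coef_wide _ sL) mulr_sumr mulr_suml; apply: eq_bigr => k _.
  rewrite /euler_kernel (_ : s k - 1 = alpha0 + (j + k)%:R); last by rewrite /s; ring.
  by rewrite powRD ?(gt_eqF x0) ?implybT// powR_mulrn ?(ltW x0)// exprD; ring.
have [_ ->] := Rintegral_sum_euler_kernel m (fun k => L`_k) c0 s0.
rewrite mulr_sumr; apply: eq_bigr => k _.
rewrite /s Gamma_poch// powRD ?(gt_eqF c0) ?implybT// powR_mulrn ?(ltW c0)//.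
field; rewrite expf_neq0 ?gt_eqF//.
by rewrite powR_gt0.
Qed.

Variables (n : 'I_p -> nat) (c : 'I_p -> R) (alpha0 : R).
Hypotheses (halpha0 : -1 < alpha0) (hc : forall q, 0 < c q) (hinj : injective c).
Local Notation N := (mabs n).

Lemma is_laguerre2_typeIE (L : {ffun 'I_p -> {poly R}}) :
  is_laguerre2_typeI n c alpha0 L <->
  (forall q, (size (L q) <= n q)%N) /\
  forall j, (j < N)%N ->
    laguerre_moment n c alpha0 (fun q k => (L q)`_k) j = (j == N.-1)%:R.
Proof.
have e j : (forall q, (size (L q) <= n q)%N) ->
  \sum_(i < p) \int[@lebesgue_measure R]_(x in `]0, +oo[)
       (x ^+ j * (L i).[x] * (x `^ alpha0 * expR (- (c i * x)))) =
  laguerre_moment n c alpha0 (fun q k => (L q)`_k) j.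
  move=> sL; apply: eq_bigr => q _; exact: Rintegral_poly_moment.
by split=> -[sL h]; split=> // j jN; have := h j jN; rewrite e//; case: eqP.
Qed.

(** The right-hand side [y] is kept free: y = 1 gives the orthogonality
    conditions and y = 0 the homogeneous system, whose solutions must vanish. *)
Lemma laguerre_coef (L : 'I_p -> nat -> R) (y : R) i k0 : (k0 < n i)%N ->
  (forall j, (j < N)%N -> laguerre_moment n c alpha0 L j = (j == N.-1)%:R * y) ->
  L i k0 = y * (c i `^ (alpha0 + N%:R) / Gamma (alpha0 + N%:R)
    * \prod_(q < p | q != i) (c q / (c q - c i)) ^+ n q)
    * (c i ^+ k0 / k0`!%:R * (weight_series n c alpha0 i (n i))`_((n i).-1 - k0)).
Proof.
move=> kn hL; have ni : (1 <= n i)%N by apply: leq_trans kn.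
have a0 : 0 < alpha0 + 1 by rewrite -ltrBlDr sub0r.
have N0 := mabs_gt0 ni.
have [w wN] := coef_isolation halpha0 hc hinj ni kn.
move=> /(_ L); rewrite -(prednK N0) big_ord_recr /= big1 ?add0r; last first.
  move=> j _; rewrite hL; last by rewrite -[ltnRHS](prednK N0) ltnW// ltnS.
  by rewrite ltn_eqF ?mul0r ?mulr0.
rewrite hL ?prednK// eqxx mul1r wN.
set W := (weight_series _ _ _ _ _)`_ _; set P := \prod_(_ < _ | _) _ => e.
have -> : alpha0 + N%:R = alpha0 + 1 + N.-1%:R by rewrite -[in LHS](prednK N0) -natr1; ring.
rewrite Gamma_poch// powRD ?(gt_eqF (hc i)) ?implybT// powR_mulrn ?(ltW (hc i))//.
have G0 : Gamma (alpha0 + 1) != 0 by rewrite gt_eqF ?Gamma_gt0.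
have c0 : c i != 0 by rewrite gt_eqF.
have ca0 : c i `^ (alpha0 + 1) != 0 by rewrite gt_eqF ?powR_gt0.
have f0 : k0`!%:R != 0 :> R by rewrite pnatr_eq0 -lt0n fact_gt0.
have D0 : Gamma (alpha0 + 1) / c i `^ (alpha0 + 1) * (k0`!%:R / c i ^+ (N.-1 + k0)) != 0.
  by rewrite !mulf_neq0 ?invr_neq0 ?expf_neq0.
apply: (mulIf D0); rewrite -e exprD; field.
by rewrite poch_neq0// !expf_neq0//= ca0 G0 f0.
Qed.

Lemma laguerre_exists_unique : exists! L, is_laguerre2_typeI n c alpha0 L.
Proof.
pose T := {q : 'I_p & 'I_(n q)}.
pose a := alpha0 + 1.
pose M (t : T) j := Gamma a / c (tag t) `^ a *
  (poch a (j + tagged t) / c (tag t) ^+ (j + tagged t)).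
have cardT : #|{: T}| = N.
  rewrite card_tagged sumnE big_map big_enum /=.
  by apply: eq_bigr => q _; rewrite card_ord.
(* The index k is a plain natural number in [laguerre_moment]; outside the
   range of degrees the family is extended by zero. *)
pose ext (v : T -> R) (q : 'I_p) (k : nat) : R :=
  if insub k is Some o then v (Tagged (fun q => 'I_(n q)) (o : 'I_(n q))) else 0.
have sumE (v : T -> R) j :
    \sum_t v t * M t j = laguerre_moment n c alpha0 (ext v) j.
  transitivity (\sum_(q < p) \sum_(k < n q) v (Tagged (fun q => 'I_(n q)) k) *
      M (Tagged (fun q => 'I_(n q)) k) j).
    rewrite sig_big_dep /=; apply: eq_big => // -[q k] _ //.
  apply: eq_bigr => q _; rewrite mulr_sumr; apply: eq_bigr => k _.
  by rewrite /ext valK /M /= mulrCA.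
have [v hv] : exists v : T -> R, forall j, (j < N)%N ->
    \sum_t v t * M t j = (j == N.-1)%:R.
  apply: (injective_system_solvable _ cardT) => v hv [q k].
  have := @laguerre_coef (ext v) 0 q k (ltn_ord k); rewrite /ext valK => ->.
    by rewrite !mul0r.
  by move=> j jN; rewrite -sumE hv// mulr0.
pose L := [ffun q => \poly_(k < n q) ext v q k].
have hL : is_laguerre2_typeI n c alpha0 L.
  apply/is_laguerre2_typeIE; split=> [q|j jN]; first by rewrite ffunE size_poly.
  rewrite -hv// sumE; apply: eq_bigr => q _; congr (_ * _); apply: eq_bigr => k _.
  by rewrite ffunE coef_poly ltn_ord.
exists L; split=> // L' hL'.
apply/ffunP => q; apply/polyP => k.
have [sL eL] := (is_laguerre2_typeIE _).1 hL.
have [sL' eL'] := (is_laguerre2_typeIE _).1 hL'.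
have [kn|nk] := ltnP k (n q); last by rewrite !nth_default// (leq_trans _ nk).
rewrite (@laguerre_coef (fun q k => (L q)`_k) 1 q k)//; last by move=> j /eL ->; rewrite mulr1.
by rewrite (@laguerre_coef (fun q k => (L' q)`_k) 1 q k)// => j /eL' ->; rewrite mulr1.
Qed.

Lemma laguerre_horner (L : {ffun 'I_p -> {poly R}}) i x : (0 < n i)%N ->
  is_laguerre2_typeI n c alpha0 L ->
  (L i).[x] = c i `^ (alpha0 + N%:R) / Gamma (alpha0 + N%:R)
    * \prod_(q < p | q != i) (c q / (c q - c i)) ^+ n q
    * (exp_series (n i) (c i * x) * weight_series n c alpha0 i (n i))`_(n i).-1.
Proof.
move=> ni /is_laguerre2_typeIE [sL eL].
rewrite (horner_coef_wide _ (sL i)) coefM prednK// mulr_sumr; apply: eq_bigr => k _.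
rewrite (@laguerre_coef (fun q k => (L q)`_k) 1 i k)//; last by move=> j /eL ->; rewrite mulr1.
by rewrite coef_poly ltn_ord exprMn; ring.
Qed.

End System.

(** * Nested sums and multiple series as coefficients *)

Section Sums.
Context {R : realType}.

Lemma eq_nested_sum p m (f g : seq nat -> R) :
  (forall l, size l = p -> f l = g l) -> nested_sum p m f = nested_sum p m g.
Proof.
elim: p m f g => [|p IH] m f g fg /=; first exact: fg.
by apply: eq_bigr => l _; apply: IH => s sp; apply: fg; rewrite /= sp.
Qed.

(** Both sides sum F l r over l + r <= m. *)
Lemma sum_triangle m (F : nat -> nat -> R) :
  \sum_(s < m.+1) \sum_(l < s.+1) F l (s - l)%N =
  \sum_(0 <= l < m.+1) \sum_(s < (m - l).+1) F l s.
Proof.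
transitivity (\sum_(0 <= s < m.+1) \sum_(0 <= l < m.+1 | (l <= s)%N) F l (s - l)%N).
  rewrite big_mkord; apply: eq_bigr => s _.
  by rewrite big_mkord (big_ord_widen_cond m.+1 xpredT (fun l => F l (s - l)%N)).
rewrite (exchange_big_dep_nat xpredT) //=; apply: eq_big_nat => l /andP[_ lm].
rewrite -(big_nat_widenl l 0 m.+1 xpredT (fun s => F l (s - l)%N))//.
rewrite -{1}(add0n l) big_addn subSn//.
by rewrite big_mkord; apply: eq_bigr => s _; rewrite addnK.
Qed.

(** A summand whose only coupling between indices is through their sum is
    regrouped by the value of that sum, which turns the rest into a coefficient
    of a product of polynomials. *)
Lemma nested_sum_prod p M m (G : nat -> R) (phi : 'I_p -> nat -> R) : (m < M)%N ->
  nested_sum p m (fun l => G (sumn l) * \prod_(q < p) phi q (nth 0%N l q)) =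
  \sum_(s < m.+1) G s * (\prod_(q < p) \poly_(k < M) phi q k)`_s.
Proof.
elim: p m G phi => [|p IH] m G phi mM /=.
  rewrite !big_ord0 big_ord_recl coef1 big1 ?addr0// => s _.
  by rewrite coef1 mulr0.
pose P := \prod_(q < p) \poly_(k < M) phi (lift ord0 q) k.
transitivity (\sum_(0 <= l < m.+1) \sum_(s < (m - l).+1)
    G (l + s)%N * (phi ord0 l * P`_s)).
  apply: eq_big_nat => l /andP[_ lm].
  under eq_bigr do rewrite mulrA.
  rewrite -(IH _ (fun s => G (l + s)%N * phi ord0 l)); last by lia.
  by apply: eq_nested_sum => s _; rewrite big_ord_recl /= mulrA.
rewrite -(sum_triangle m (fun l s => G (l + s)%N * (phi ord0 l * P`_s))).
apply: eq_bigr => s _; rewrite [in RHS]big_ord_recl coefM mulr_sumr; apply: eq_bigr => l _.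
have ls : (l <= s)%N by rewrite -ltnS.
rewrite subnKC// coef_poly ifT//.
by rewrite (leq_ltn_trans ls)// (leq_trans (ltn_ord s)).
Qed.

Lemma multi_series0 p : multi_series p (fun=> 0 : R) = 0.
Proof.
elim: p => //= p IH; apply: cvg_lim => //.
under eq_fun => N do under eq_bigr do rewrite IH.
by under eq_fun do rewrite big1//; exact: cvg_cst.
Qed.

(** The vanishing makes all the iterated partial sums eventually constant. *)
Lemma multi_series_nested_sum p m (f : seq nat -> R) :
  (forall l, (m < sumn l)%N -> f l = 0) ->
  multi_series p f = nested_sum p m f.
Proof.
elim: p m f => [|p IH] m f f0 //=; apply: cvg_lim => //.
have fl l : (m < l)%N -> multi_series p (fun s => f (l :: s)) = 0.
  move=> ml; rewrite -[RHS](multi_series0 p); congr multi_series.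
  by apply/funext => s; apply: f0; rewrite /= (leq_trans ml) ?leq_addr.
apply: cvg_near_cst; near=> N.
have mN : (m.+1 <= N)%N by near: N; exact: nbhs_infty_ge.
rewrite (big_cat_nat (leq0n m.+1) mN)//= [X in _ + X]big_nat_cond [X in _ + X]big1 ?addr0.
  apply: eq_big_nat => l /andP[_ lm]; apply: IH => s ls; apply: f0 => /=; lia.
by move=> l /andP[/andP[ml _] _]; exact: fl.
Unshelve. all: by end_near. Qed.

End Sums.

Section KampeDeFeriet.
Context {R : realType} {p : nat}.
Variables (n : 'I_p -> nat) (c : 'I_p -> R) (alpha0 : R) (i : 'I_p) (x : R).
Hypotheses (halpha0 : -1 < alpha0) (hni : (1 <= n i)%N).
Local Notation N := (mabs n).
Let m := (n i).-1.
Let d : R := alpha0 + N%:R - (n i)%:R + 1.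

Let d_gt0 : 0 < d.
Proof.
have : (n i)%:R <= N%:R :> R by rewrite ler_nat /mabs (bigD1 i)//= leq_addr.
by move: halpha0; rewrite /d; lra.
Qed.

(** The factor (-1)^m (d)_m / m! of K_i and the quotient (- m)_s / (d)_s of the
    summand combine into the coefficient of u^(m - s) in (1 - u)^b. *)
Let const_coef s : (s <= m)%N ->
  (-1) ^+ m * poch d m / m`!%:R * (poch (- m%:R) s / poch d s) =
  poch (- (alpha0 + N%:R - 1)) (m - s) / (m - s)`!%:R.
Proof.
move=> sm; rewrite -[in poch d m](subnKC sm) pochD poch_oppn//.
have -> : d + s%:R = alpha0 + N%:R - 1 + 1 - (m - s)%:R.
  by rewrite natrB// /d -(prednK hni) -natr1; ring.
rewrite poch_reflect -{1}(subnK sm) exprD.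
have f0 k : k`!%:R != 0 :> R by rewrite pnatr_eq0 -lt0n fact_gt0.
have ds := poch_neq0 s d_gt0.
set P := poch (- _) _.
have s1 k : (-1) ^+ k * (-1) ^+ k = 1 :> R by rewrite -exprD addnn -signr_odd odd_double.
transitivity (((-1) ^+ s * (-1) ^+ s) * (((-1) ^+ (m - s) * (-1) ^+ (m - s)) *
  (P / (m - s)`!%:R))); last by rewrite !s1 !mul1r.
by field; rewrite !f0 ds.
Qed.

(** The hypothesis on [f] is the common normal form of the summands of the
    hypergeometric series and of the nested sum. *)
Lemma laguerre2_const_nested_sum (f : seq nat -> R) :
  (forall l, size l = p -> f l =
    poch (- m%:R) (sumn l) / poch d (sumn l) *
    \prod_(q < p) (if q == i then (c i * x) ^+ nth 0%N l q / (nth 0%N l q)`!%:R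
      else poch (n q)%:R (nth 0%N l q) / (nth 0%N l q)`!%:R
           * (c i / (c i - c q)) ^+ nth 0%N l q)) ->
  laguerre2_const n c alpha0 i * nested_sum p m f =
  c i `^ (alpha0 + N%:R) / Gamma (alpha0 + N%:R)
    * \prod_(q < p | q != i) (c q / (c q - c i)) ^+ n q
    * (exp_series (n i) (c i * x) * weight_series n c alpha0 i (n i))`_m.
Proof.
move=> hf; rewrite (eq_nested_sum _ hf).
have mM : (m < n i)%N by rewrite /m prednK.
rewrite (@nested_sum_prod R p (n i) m (fun s => poch (- m%:R) s / poch d s) (fun q k =>
  if q == i then (c i * x) ^+ k / k`!%:R
      else poch (n q)%:R k / k`!%:R * (c i / (c i - c q)) ^+ k))//.
have -> : \prod_(q < p) (\poly_(k < n i) (if q == i then (c i * x) ^+ k / k`!%:R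
      else poch (n q)%:R k / k`!%:R * (c i / (c i - c q)) ^+ k)) =
    exp_series (n i) (c i * x) * pole_series n c i (n i).
  rewrite (bigD1 i)//= eqxx; congr (_ * _); apply: eq_bigr => q /negPf qi.
  by rewrite qi.
rewrite /weight_series mulrCA [binser _ _ _ * _]mulrC coefM !mulr_sumr; apply: eq_bigr => s _.
have sm : (s <= m)%N by rewrite -ltnS.
rewrite [in RHS]coef_poly expr1n mulr1 ifT; last by lia.
rewrite -const_coef// /laguerre2_const -/m -/d.
have f0 k : k`!%:R != 0 :> R by rewrite pnatr_eq0 -lt0n fact_gt0.
have ds := poch_neq0 s d_gt0.
have G0 : Gamma (alpha0 + N%:R) != 0.
  have -> : alpha0 + N%:R = d + m%:R.
    by rewrite /d -[in RHS](prednK hni) -/m -natr1; ring.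
  by apply/lt0r_neq0/Gamma_gt0; rewrite ltr_pwDl.
by field; rewrite f0 ds G0.
Qed.

End KampeDeFeriet.

(** * Asymptotics of iterated differences *)

Section ScaledDifference.
Context {R : realType}.
Implicit Types (f g : R -> nat -> R) (A B : {poly R}) (e : R).

(** The difference operator in l, scaled by t so that its iterates have finite
    limits as t goes to infinity. *)
Definition sdiff f : R -> nat -> R := fun t l => t * (f t l.+1 - f t l).

Lemma iter_sdiff_shift k f t l :
  iter k sdiff (fun t l => f t l.+1) t l = iter k sdiff f t l.+1.
Proof. by elim: k t l => //= k IH t l; rewrite /sdiff !IH. Qed.

Lemma iter_sdiffD k f g t l :
  iter k sdiff (fun t l => f t l + g t l) t l = iter k sdiff f t l + iter k sdiff g t l.
Proof. by elim: k t l => //= k IH t l; rewrite /sdiff !IH; ring. Qed.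

(** Since (- m)_j / j! is (-1)^j times a binomial coefficient, this is the usual
    expansion of an m-th difference, in the shape met in the finite sum of the
    Jacobi-Pineiro polynomial. *)
Lemma iter_sdiff_sum m f t l :
  iter m sdiff f t l =
  (- t) ^+ m * \sum_(j < m.+1) poch (- m%:R) j / j`!%:R * f t (l + j)%N.
Proof.
elim: m l => [|m IH] l /=.
  by rewrite big_ord_recl big_ord0 poch0 fact0 divr1 !mul1r addn0 addr0.
have pascal j : poch (- m.+1%:R) j.+1 / j.+1`!%:R =
    poch (- m%:R) j.+1 / j.+1`!%:R - poch (- m%:R) j / j`!%:R :> R.
  have -> : poch (- m.+1%:R) j.+1 = - m.+1%:R * poch (- m%:R) j :> R.
    by rewrite pochSl; congr (_ * poch _ _); rewrite -natr1; ring.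
  have f0 : j`!%:R != 0 :> R by rewrite pnatr_eq0 -lt0n fact_gt0.
  have j0 : j%:R + 1 != 0 :> R by rewrite natr1 pnatr_eq0.
  by rewrite pochSr factS natrM -!natr1; field; rewrite f0 j0.
have -> : \sum_(j < m.+2) poch (- m.+1%:R) j / j`!%:R * f t (l + j)%N =
    \sum_(j < m.+1) poch (- m%:R) j / j`!%:R * f t (l + j)%N -
    \sum_(j < m.+1) poch (- m%:R) j / j`!%:R * f t (l.+1 + j)%N.
  rewrite big_ord_recl [in RHS]big_ord_recl /= !poch0 -addrA; congr (_ + _).
  under eq_bigr => j _ do rewrite /bump add1n pascal mulrBl addnS -addSn.
  rewrite sumrB; congr (_ - _); rewrite big_ord_recr /= poch_oppn_eq0//.
  rewrite !mul0r addr0; apply: eq_bigr => j _.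
  by rewrite /bump add1n addnS -addSn.
by rewrite /sdiff !IH exprS; ring.
Qed.

(** At scale t, f t l behaves like A(e v) at v = l / t, as far as differences of
    order at most k can see; e is a change of variable in the series. *)
Definition expands e k f A := forall j, (j <= k)%N -> forall l,
  iter j sdiff f t l @[t --> +oo] --> (j`!%:R * e ^+ j * A`_j : R).

Lemma expandsW e k k' f A : (k' <= k)%N -> expands e k f A -> expands e k' f A.
Proof. by move=> kk' h j jk; apply: h; apply: leq_trans kk'. Qed.

Lemma expands_sdiff e k f A :
  expands e k.+1 f A -> expands e k (sdiff f) (e *: A^`()).
Proof.
move=> h j jk l; have := h j.+1 jk l; rewrite iterSr.
rewrite coefZ coef_deriv.
have -> : j`!%:R * e ^+ j * (e * (A`_j.+1 *+ j.+1)) = j.+1`!%:R * e ^+ j.+1 * A`_j.+1.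
  by rewrite factS natrM exprS -[_ *+ _]mulr_natr; ring.
by [].
Qed.

Lemma expands_shift e k f A : expands e k f A -> expands e k (fun t l => f t l.+1) A.
Proof.
move=> h j jk l; under eq_fun do rewrite iter_sdiff_shift; exact: h.
Qed.

(** Induction on the order, using that [sdiff] satisfies the Leibniz rule up to a
    shift in l, which the limit does not see, and that on the series side it acts
    as the derivation e A'. *)
Lemma cvg_iter_sdiffM e k f g A B l : expands e k f A -> expands e k g B ->
  iter k sdiff (fun t l => f t l * g t l) t l @[t --> +oo] -->
  (k`!%:R * e ^+ k * (A * B)`_k : R).
Proof.
elim: k f g A B l => [|k IH] f g A B l hf hg.
  rewrite fact0 expr0 !mul1r coef0M; apply: cvgM.
    by have := hf 0%N (leqnn _) l; rewrite fact0 expr0 !mul1r.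
  by have := hg 0%N (leqnn _) l; rewrite fact0 expr0 !mul1r.
have -> : (fun t : R => iter k.+1 sdiff (fun t l => f t l * g t l) t l) =
  (fun t => iter k sdiff (fun t l => sdiff f t l * g t l.+1) t l +
            iter k sdiff (fun t l => f t l * sdiff g t l) t l).
  apply/funext => t; rewrite -iter_sdiffD iterSr; congr (iter _ _ _ t l).
  by apply/funext => u; apply/funext => r; rewrite /sdiff; ring.
have -> : k.+1`!%:R * e ^+ k.+1 * (A * B)`_k.+1 =
    k`!%:R * e ^+ k * ((e *: A^`()) * B)`_k + k`!%:R * e ^+ k * (A * (e *: B^`()))`_k.
  rewrite -mulrDr -coefD.
  have -> : (e *: A^`()) * B + A * (e *: B^`()) = e *: (A * B)^`().
    by rewrite derivM scalerDr -scalerAl -scalerAr.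
  rewrite coefZ coef_deriv.
  by rewrite factS natrM exprS -[_ *+ _]mulr_natr; ring.
apply: cvgD; apply: IH.
- exact: expands_sdiff.
- by apply: expands_shift; apply: expandsW hg.
- exact: expandsW hf.
- exact: expands_sdiff.
Qed.

Lemma expandsM e k f g A B : expands e k f A -> expands e k g B ->
  expands e k (fun t l => f t l * g t l) (A * B).
Proof. by move=> hf hg j jk l; apply: cvg_iter_sdiffM; apply: expandsW jk _. Qed.

Lemma expands1 e k : expands e k (fun _ _ => 1) 1.
Proof.
move=> [|j] _ l; first by rewrite fact0 expr0 !mul1r coef1; exact: cvg_cst.
rewrite coef1 mulr0; under eq_fun => t.
  rewrite iterSr (_ : sdiff _ = fun _ _ => 0); last first.
    by apply/funext => u; apply/funext => r; rewrite /sdiff subrr mulr0.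
  rewrite (_ : iter _ _ _ _ _ = 0); first by over.
  by elim: j l => //= j IH l; rewrite /sdiff !IH subrr mulr0.
exact: cvg_cst.
Qed.

Lemma expands_prod e k (I : Type) (r : seq I) (P : pred I) (F : I -> R -> nat -> R)
    (G : I -> {poly R}) :
  (forall q, P q -> expands e k (F q) (G q)) ->
  expands e k (fun t l => \prod_(q <- r | P q) F q t l) (\prod_(q <- r | P q) G q).
Proof.
move=> h; elim: r => [|q r IH].
  rewrite big_nil (_ : (fun t l => _) = (fun _ _ => 1)); first exact: expands1.
  by apply/funext => t; apply/funext => l; rewrite big_nil.
have e' : (fun t l => \prod_(q <- q :: r | P q) F q t l) =
    (fun t l => if P q then F q t l * \prod_(q <- r | P q) F q t l
                else \prod_(q <- r | P q) F q t l).
  by apply/funext => t; apply/funext => l; rewrite big_cons.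
rewrite e' big_cons; case: ifP => // Pq.
by apply: expandsM => //; exact: h.
Qed.

Lemma expands_expn e k M x y : (k < M)%N -> e * y = - x ->
  expands e k (fun t l => (1 - x / t) ^+ l) (exp_series M y).
Proof.
move=> kM ey j jk l; rewrite coef_poly (leq_ltn_trans jk kM).
have -> : j`!%:R * e ^+ j * (y ^+ j / j`!%:R) = (- x) ^+ j * 1.
  rewrite -ey exprMn; field; by rewrite pnatr_eq0 -lt0n fact_gt0.
have : (- x) ^+ j * (1 - x / t) ^+ l @[t --> +oo] --> (- x) ^+ j * 1.
  apply: cvgMr.
  have h : (1 - x * t^-1) @[t --> +oo] --> (1 : R).
    rewrite -[X in _ --> X]subr0; apply: cvgB; first exact: cvg_cst.
    by rewrite -[X in _ --> X](mulr0 x); apply: cvgMr; exact: cvgy_inv.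
  rewrite -[X in _ --> X](expr1n R l); elim: l => [|l IH].
    by under eq_fun do rewrite expr0; rewrite expr0; exact: cvg_cst.
  by under eq_fun do rewrite exprS; rewrite exprS; apply: cvgM.
apply: cvg_trans; apply: near_eq_cvg; near=> t.
have t0 : t != 0 by rewrite gt_eqF//; near: t; exact: nbhs_pinfty_gt.
elim: j l {jk} => [|j IH] l; first by rewrite mul1r.
by rewrite iterS /sdiff -!IH exprS [_ ^+ l.+1]exprS; field.
Unshelve. all: by end_near. Qed.

Lemma cvgy_poch (c d : R) k :
  poch (c * t + d) k / t ^+ k @[t --> +oo] --> (c ^+ k : R).
Proof.
elim: k => [|k IH].
  by under eq_fun do rewrite poch0 expr0 divr1; rewrite expr0; exact: cvg_cst.
have h : c + (d + k%:R) * t^-1 @[t --> +oo] --> (c : R).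
  rewrite -[X in _ --> X]addr0; apply: cvgD; first exact: cvg_cst.
  by rewrite -[X in _ --> X](mulr0 (d + k%:R)); apply: cvgMr; exact: cvgy_inv.
have : poch (c * t + d) k / t ^+ k * (c + (d + k%:R) * t^-1) @[t --> +oo] -->
    (c ^+ k.+1 : R) by rewrite exprSr; apply: cvgM.
apply: cvg_trans; apply: near_eq_cvg; near=> t.
have t0 : t != 0 by rewrite gt_eqF//; near: t; exact: nbhs_pinfty_gt.
by rewrite pochSr /= exprS; field; rewrite t0 expf_neq0.
Unshelve. all: by end_near. Qed.

Lemma near_poch_neq0 (c d : R) k : c != 0 ->
  \forall t \near +oo, poch (c * t + d) k != 0.
Proof.
move=> c0.
have h : poch (c * t + d) k / t ^+ k @[t --> +oo] --> (c ^+ k : R) by exact: cvgy_poch.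
have nz := cvgr_neq0 _ h (expf_neq0 k c0).
near=> t; have : poch (c * t + d) k / t ^+ k != 0 by near: t; exact: nz.
by apply: contra_neq => ->; rewrite mul0r.
Unshelve. all: by end_near. Qed.

(** One difference replaces (c t + b)_l by (c t + b)_(l + 1) in the denominator
    and multiplies by a - b - j, so all iterates are in closed form. *)
Lemma iter_sdiff_poch_ratio (c a b t : R) j l : poch (c * t + b) (j + l) != 0 ->
  iter j sdiff (fun t l => poch (c * t + a) l / poch (c * t + b) l) t l =
  t ^+ j * ((-1) ^+ j * poch (- (a - b)) j) *
    (poch (c * t + a) l / poch (c * t + b) (j + l)).
Proof.
elim: j l => [|j IH] l p0; first by rewrite !expr0 poch0 !mul1r.
move: p0; rewrite addSn -addnS => p0; rewrite iterS /sdiff IH//.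
move: p0; rewrite addnS pochSr mulf_eq0 negb_or => /andP[p0 q0].
rewrite natrD in q0; rewrite IH// !pochSr !exprS natrD; field.
by rewrite p0 q0.
Qed.

Lemma expands_poch_ratio e k M (c a b y : R) : c != 0 -> (k < M)%N -> e * y * c = - 1 ->
  expands e k (fun t l => poch (c * t + a) l / poch (c * t + b) l)
    (binser M (- (a - b)) y).
Proof.
move=> c0 kM eyc j jk l; rewrite coef_poly (leq_ltn_trans jk kM).
have -> : j`!%:R * e ^+ j * (poch (- (a - b)) j / j`!%:R * y ^+ j) =
    (-1) ^+ j * poch (- (a - b)) j * (c ^+ l / c ^+ (j + l)).
  have ey : e * y = - c^-1 by apply: (mulIf c0); rewrite eyc mulNr mulVf.
  have -> : j`!%:R * e ^+ j * (poch (- (a - b)) j / j`!%:R * y ^+ j) =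
     poch (- (a - b)) j * (e * y) ^+ j.
    by rewrite exprMn; field; rewrite pnatr_eq0 -lt0n fact_gt0.
  rewrite ey [in LHS]exprNn exprVn exprD; field.
  by rewrite !expf_neq0.
have : (-1) ^+ j * poch (- (a - b)) j *
    ((poch (c * t + a) l / t ^+ l) / (poch (c * t + b) (j + l) / t ^+ (j + l)))
    @[t --> +oo] --> (-1) ^+ j * poch (- (a - b)) j * (c ^+ l / c ^+ (j + l)).
  apply: cvgMr; apply: cvgM; first exact: cvgy_poch.
  by apply: cvgV; [exact: expf_neq0|exact: cvgy_poch].
apply: cvg_trans; apply: near_eq_cvg; near=> t.
have t0 : t != 0 by rewrite gt_eqF//; near: t; exact: nbhs_pinfty_gt.
have p0 : poch (c * t + b) (j + l) != 0 by near: t; exact: near_poch_neq0.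
transitivity (t ^+ j * ((-1) ^+ j * poch (- (a - b)) j) *
    (poch (c * t + a) l / poch (c * t + b) (j + l))).
  by rewrite exprD; field; rewrite p0 !expf_neq0.
by rewrite iter_sdiff_poch_ratio.
Unshelve. all: by end_near. Qed.

End ScaledDifference.

(** * The limit from the Jacobi-Pineiro polynomials *)

Lemma cvg_prodr (R : realType) (I : Type) (r : seq I) (P : pred I)
    (F : I -> R -> R) (G : I -> R) :
  (forall q, P q -> F q t @[t --> +oo] --> G q) ->
  \prod_(q <- r | P q) F q t @[t --> +oo] --> \prod_(q <- r | P q) G q.
Proof.
move=> h; elim: r => [|q r IH].
  by under eq_fun do rewrite big_nil; rewrite big_nil; exact: cvg_cst.
under eq_fun do rewrite big_cons; rewrite big_cons; case: ifP => // Pq.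
by apply: cvgM => //; exact: h.
Qed.

Section JacobiPineiroLimit.
Context {R : realType} {p : nat}.
Variables (n : 'I_p -> nat) (c : 'I_p -> R) (alpha0 : R) (i : 'I_p) (x : R).
Hypotheses (halpha0 : -1 < alpha0) (hc : forall q, 0 < c q) (hinj : injective c).
Hypothesis hni : (1 <= n i)%N.
Local Notation N := (mabs n).
Let m := (n i).-1.

Let jpterm (t : R) (l : nat) : R :=
  poch (c i * t + (alpha0 + N%:R)) l / poch (c i * t + 1) l *
  \prod_(q < p | q != i) (poch ((c i - c q) * t + (1 - (n q)%:R)) l
                          / poch ((c i - c q) * t + 1) l) *
  (1 - x / t) ^+ l.

Let cne q : q != i -> c i - c q != 0.
Proof. by move=> qi; rewrite subr_eq0; apply: contra_neq qi => /hinj. Qed.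

Let mni : (m < n i)%N. Proof. by rewrite /m prednK. Qed.

(** The factors expand in v as (1 + v / c_i)^b, (1 + v / (c_i - c_q))^(- n_q) and
    e^(- x v); the change of variable v = - c_i u, that is e = - 1 / c_i, makes
    them the factors of W(u). *)
Let expands_jpterm :
  expands (- (c i)^-1) m jpterm (exp_series (n i) (c i * x) * weight_series n c alpha0 i (n i)).
Proof.
have c0 : c i != 0 by rewrite gt_eqF.
rewrite mulrC; apply: expandsM; last first.
  by apply: expands_expn mni _; rewrite mulNr mulKf.
apply: expandsM.
  by apply: expands_poch_ratio => //; rewrite mulr1 mulNr mulVf.
apply: expands_prod => q qi.
have -> : binser (n i) (n q)%:R (c i / (c i - c q)) =
    binser (n i) (- (1 - (n q)%:R - 1)) (c i / (c i - c q)) by congr binser; ring.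
apply: expands_poch_ratio => //; first exact: cne.
by field; rewrite c0 cne.
Qed.

Lemma jacobi_pineiro_cvg :
  (-1) ^+ N.-1 / t `^ (alpha0 + N%:R)
     * (jacobi_pineiro_typeI n (fun q => c q * t) alpha0 i).[1 - x / t]
  @[t --> +oo] -->
  c i `^ (alpha0 + N%:R) / Gamma (alpha0 + N%:R)
    * \prod_(q < p | q != i) (c q / (c q - c i)) ^+ n q
    * (exp_series (n i) (c i * x) * weight_series n c alpha0 i (n i))`_m.
Proof.
have c0 : c i != 0 by rewrite gt_eqF.
have N0 : (0 < N)%N by exact: mabs_gt0 hni.
have s0 : 0 < alpha0 + N%:R.
  have : 1 <= N%:R :> R by rewrite ler1n.
  by move: halpha0; lra.
have G0 : Gamma (alpha0 + N%:R) != 0 by apply/lt0r_neq0/Gamma_gt0.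
have f0 : m`!%:R != 0 :> R by rewrite pnatr_eq0 -lt0n fact_gt0.
pose W := (exp_series (n i) (c i * x) * weight_series n c alpha0 i (n i))`_m.
(* U, V and H are the factors other than the finite sum, freed of their powers of
   t; the sum takes the remaining power t^m. *)
pose U t := \prod_(q < p) (poch (c q * t + (alpha0 + N%:R)) (n q) / t ^+ n q).
pose V t := \prod_(q < p | q != i) (poch ((c q - c i) * t + 0) (n q) / t ^+ n q).
pose H t := Gamma (c i * t + (alpha0 + N%:R)) /
   (Gamma (c i * t) * (c i * t) `^ (alpha0 + N%:R)).
have cU : U t @[t --> +oo] --> \prod_(q < p) c q ^+ n q.
  apply: cvg_prodr => q _; exact: cvgy_poch.
have cV : V t @[t --> +oo] --> \prod_(q < p | q != i) (c q - c i) ^+ n q.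
  apply: cvg_prodr => q _; exact: cvgy_poch.
have cH : H t @[t --> +oo] --> (1 : R).
  have := Gamma_ratio (ltW s0).
  apply: (@cvg_comp _ _ _ (fun t => c i * t)); exact: gt0_cvgMry.
have cS := expands_jpterm (leqnn m) 0%N.
have P0 : \prod_(q < p | q != i) (c q - c i) ^+ n q != 0.
  apply/prodf_neq0 => q qi; rewrite expf_neq0// -opprB oppr_eq0; exact: cne.
have cT : (m`!%:R * Gamma (alpha0 + N%:R))^-1 * (-1) ^+ m * U t / V t *
    (H t * (c i `^ (alpha0 + N%:R) / c i)) * iter m sdiff jpterm t 0
    @[t --> +oo] -->
  (m`!%:R * Gamma (alpha0 + N%:R))^-1 * (-1) ^+ m * (\prod_(q < p) c q ^+ n q) /
    (\prod_(q < p | q != i) (c q - c i) ^+ n q) *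
    (1 * (c i `^ (alpha0 + N%:R) / c i)) * (m`!%:R * (- (c i)^-1) ^+ m * W).
  apply: cvgM cS; apply: cvgM; last by apply: cvgM => //; exact: cvg_cst.
  apply: cvgM; last exact: cvgV.
  by apply: cvgM => //; exact: cvg_cst.
have <- : (m`!%:R * Gamma (alpha0 + N%:R))^-1 * (-1) ^+ m * (\prod_(q < p) c q ^+ n q) /
    (\prod_(q < p | q != i) (c q - c i) ^+ n q) *
    (1 * (c i `^ (alpha0 + N%:R) / c i)) * (m`!%:R * (- (c i)^-1) ^+ m * W) =
  c i `^ (alpha0 + N%:R) / Gamma (alpha0 + N%:R)
    * \prod_(q < p | q != i) (c q / (c q - c i)) ^+ n q * W.
  have -> : \prod_(q < p | q != i) (c q / (c q - c i)) ^+ n q =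
      (\prod_(q < p | q != i) c q ^+ n q) / \prod_(q < p | q != i) (c q - c i) ^+ n q.
    rewrite -prodfV -big_split /=; apply: eq_bigr => q _.
    by rewrite exprMn exprVn.
  rewrite (bigD1 i)//=.
  have -> : c i ^+ n i = c i * c i ^+ m by rewrite -exprS /m prednK.
  have -> : (- (c i)^-1) ^+ m = (-1) ^+ m / c i ^+ m by rewrite [in LHS]exprNn exprVn.
  have s1 : (-1) ^+ m * (-1) ^+ m = 1 :> R by rewrite -exprD addnn -signr_odd odd_double.
  transitivity (((-1) ^+ m * (-1) ^+ m) * (c i `^ (alpha0 + N%:R) / Gamma (alpha0 + N%:R) *
    (\prod_(q < p | q != i) c q ^+ n q / \prod_(q < p | q != i) (c q - c i) ^+ n q) * W)).
    by field; rewrite f0 G0 P0 c0 expf_neq0.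
  by rewrite s1 mul1r.
move: cT; apply: cvg_trans; apply: near_eq_cvg; near=> t.
have t0 : 0 < t by near: t; exact: nbhs_pinfty_gt.
have tn0 : t != 0 by rewrite gt_eqF.
have Vt0 : V t != 0 by near: t; exact: (cvgr_neq0 _ cV P0).
have cit0 : 0 < c i * t by rewrite mulr_gt0.
rewrite iter_sdiff_sum prednK//.
have -> : (jacobi_pineiro_typeI n (fun q => c q * t) alpha0 i).[1 - x / t] =
  (-1) ^+ N.-1 *
  (\prod_(q < p) poch (c q * t + (alpha0 + N%:R)) (n q) /
    (m`!%:R * \prod_(q < p | q != i) poch ((c q - c i) * t + 0) (n q)))
  * (Gamma (c i * t + (alpha0 + N%:R)) /
     (Gamma (alpha0 + N%:R) * (c i * t * Gamma (c i * t)))) *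
  \sum_(l < n i) poch (- m%:R) l / l`!%:R * jpterm t l.
  rewrite /jacobi_pineiro_typeI -/m hornerZ horner_sum -GammaS// big_mkord.
  have -> : \prod_(q < p) poch (c q * t + alpha0 + N%:R) (n q) =
      \prod_(q < p) poch (c q * t + (alpha0 + N%:R)) (n q).
    by apply: eq_bigr => q _; rewrite addrA.
  have -> : \prod_(q < p | q != i) poch (c q * t - c i * t) (n q) =
      \prod_(q < p | q != i) poch ((c q - c i) * t + 0) (n q).
    by apply: eq_bigr => q _; rewrite addr0 mulrBl.
  rewrite -(addrA (c i * t)); congr (_ * _); apply: eq_bigr => l _.
  rewrite hornerZ hornerXn /jpterm !mulrA; congr (_ * _).
  have -> : - (n i)%:R + 1 = - m%:R :> R by rewrite -(prednK hni) -/m -natr1; ring.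
  rewrite invfM.
  have -> : \prod_(q < p | q != i) (poch (c i * t - c q * t - (n q)%:R + 1) l /
        poch (c i * t - c q * t + 1) l) =
      \prod_(q < p | q != i) (poch ((c i - c q) * t + (1 - (n q)%:R)) l /
        poch ((c i - c q) * t + 1) l).
    by apply: eq_bigr => q _; rewrite mulrBl; congr (poch _ _ / _); ring.
  ring.
set S := \sum_(l < n i) _ * jpterm t l.
move: Vt0; rewrite /U /V /H !big_split /= !prodfV !prodrXr.
set PU := \prod_(q < p) _; set PV := \prod_(q < p | _) _.
have -> : (\sum_(q < p) n q = m.+1 + \sum_(q < p | q != i) n q)%N.
  by rewrite (bigD1 i)//= prednK.
set e := (\sum_(q < p | q != i) n q)%N.
rewrite mulf_eq0 negb_or => /andP[PV0 _].
rewrite powRM ?(ltW t0) ?(ltW (hc i))//.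
set GG := Gamma (c i * t + _).
have G1 : Gamma (c i * t) != 0 by apply/lt0r_neq0/Gamma_gt0.
have p1 : t `^ (alpha0 + N%:R) != 0 by rewrite gt_eqF ?powR_gt0.
have p2 : c i `^ (alpha0 + N%:R) != 0 by rewrite gt_eqF ?powR_gt0.
have -> : (- t) ^+ m = (-1) ^+ m * t ^+ m by rewrite [in LHS]exprNn.
have s1 k : (-1) ^+ k * (-1) ^+ k = 1 :> R by rewrite -exprD addnn -signr_odd odd_double.
clearbody PU PV S GG e.
move: (Gamma (c i * t)) G1 (Gamma (alpha0 + N%:R)) G0 => Gt G1 Gs Gs0.
move: (t `^ _) p1 (c i `^ _) p2 => tp p1 cp p2.
have te0 k : t ^+ k != 0 by rewrite expf_neq0.
pose Y := PU / PV / (m`!%:R * Gs) * (GG / (c i * t * Gt)) / tp * S.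
transitivity (((-1) ^+ m * (-1) ^+ m) * Y).
  by rewrite exprD exprS /Y; field; rewrite f0 Gs0 PV0 c0 tn0 G1 p1 p2 !te0.
transitivity (((-1) ^+ N.-1 * (-1) ^+ N.-1) * Y); first by rewrite !s1.
by rewrite /Y; field; rewrite f0 Gs0 PV0 c0 tn0 G1 p1.
Unshelve. all: by end_near. Qed.

End JacobiPineiroLimit.

(** * Formulas for the type I Laguerre polynomials *)

Theorem theorem4p1 (R : realType) (p : nat) (alpha0 : R) (c : 'I_p -> R)
    (n : 'I_p -> nat) (i : 'I_p)
    (halpha0 : -1 < alpha0) (hc : forall q, 0 < c q) (hinj : injective c)
    (hni : (1 <= n i)%N) :
  (exists! L, is_laguerre2_typeI n c alpha0 L) /\
  forall L : {ffun 'I_p -> {poly R}}, is_laguerre2_typeI n c alpha0 L ->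
  forall x : R,
  [/\ (L i).[x] =
        laguerre2_const n c alpha0 i
        * kampe_de_feriet i (- (n i)%:R + 1) (fun q => (n q)%:R)
            (alpha0 + (mabs n)%:R - (n i)%:R + 1)
            (c i * x) (fun q => c i / (c i - c q)),
      (L i).[x] =
        laguerre2_const n c alpha0 i
        * nested_sum p (n i).-1 (fun l =>
            poch (- (n i)%:R + 1) (sumn l)
            / poch (alpha0 + (mabs n)%:R - (n i)%:R + 1) (sumn l)
            * (c i ^+ sumn l / (nth 0%N l i)`!%:R)
            * \prod_(q < p | q != i)
                (poch (n q)%:R (nth 0%N l q)
                 / ((nth 0%N l q)`!%:R * (c i - c q) ^+ nth 0%N l q))
            * x ^+ nth 0%N l i)
    & (-1) ^+ (mabs n).-1 / t `^ (alpha0 + (mabs n)%:R)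
        * (jacobi_pineiro_typeI n (fun q => c q * t) alpha0 i).[1 - x / t]
        @[t --> +oo] --> (L i).[x]].
Proof.
split; first exact: laguerre_exists_unique.
move=> L hL x.
have -> : - (n i)%:R + 1 = - (n i).-1%:R :> R by rewrite -[in LHS](prednK hni) -natr1; ring.
rewrite (laguerre_horner halpha0 hc hinj x hni hL).
split; last exact: jacobi_pineiro_cvg.
- rewrite /kampe_de_feriet (@multi_series_nested_sum _ _ (n i).-1); last first.
    by move=> l ml; rewrite poch_oppn_eq0// !mul0r.
  symmetry; apply: laguerre2_const_nested_sum => // l _.
  rewrite [in RHS](bigD1 i)//= eqxx [RHS]mulrA; congr (_ * _).
  by apply: eq_bigr => q /negPf ->; rewrite mulrAC.
symmetry; apply: laguerre2_const_nested_sum => // l sl.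
have -> : c i ^+ sumn l =
    c i ^+ nth 0%N l i * \prod_(q < p | q != i) c i ^+ nth 0%N l q.
  rewrite -[RHS](bigD1 i (P := xpredT) (F := fun q => c i ^+ nth 0%N l q))//.
  by rewrite prodrXr sumnE (big_nth 0%N) sl big_mkord.
rewrite [in RHS](bigD1 i)//= eqxx.
have -> : \prod_(q < p | q != i) (if q == i
      then (c i * x) ^+ nth 0%N l q / (nth 0%N l q)`!%:R
      else poch (n q)%:R (nth 0%N l q) / (nth 0%N l q)`!%:R
           * (c i / (c i - c q)) ^+ nth 0%N l q) =
  \prod_(q < p | q != i) c i ^+ nth 0%N l q * \prod_(q < p | q != i)
     (poch (n q)%:R (nth 0%N l q) / ((nth 0%N l q)`!%:R * (c i - c q) ^+ nth 0%N l q)).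
  rewrite -big_split /=; apply: eq_bigr => q /negPf ->.
  by rewrite exprMn exprVn invfM; ring.
by rewrite exprMn; ring.
Qed.
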